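(* Let $f: M \to N$ be a smooth map between manifolds, where $M$ is a Banach manifold and $N$ is a locally convex manifold, and let $m \in M$. Then $f$ can be brought into a normal form at $m$ if and only if the differential $T_m f: T_m M \to T_{f(m)} N$ is a regular operator. In particular, every smooth map $f: M \to N$ from a finite-dimensional manifold $M$ to a locally convex manifold $N$ can be brought into a normal form around every point.
   Context: Manifolds are smooth manifolds modeled on (possibly infinite-dimensional) locally convex spaces, with smoothness of maps between locally convex spaces in the usual Michal--Bastiani sense. A chart $\kappa: M \supseteq U' \to U \subseteq X$ at a point $m$ satisfies $\kappa(m) = 0$, with $U'$ an open neighborhood of $m$ and $U$ an open neighborhood of $0$ in the model space $X$. Regular operator: a continuous linear map $T: X \to Y$ between locally convex spaces is regular if it is relatively open (i.e. open onto its image) and its kernel and its image are closed, topologically complemented subspaces. Abstract normal form: a tuple $(X, Y, \hat f, f_{\mathrm{sing}})$ where (1) $X$ and $Y$ are locally convex spaces with topological decompositions $X = \mathrm{ker} \oplus \mathrm{coim}$ and $Y = \mathrm{coker} \oplus \mathrm{im}$ (here $\mathrm{ker}, \mathrm{coim}, \mathrm{coker}, \mathrm{im}$ are just names of the given subspaces); (2) $\hat f: \mathrm{coim} \to \mathrm{im}$ is a linear topological isomorphism; (3) $f_{\mathrm{sing}}: X \supseteq U \to \mathrm{coker}$ is a smooth map defined on an open neighborhood $U$ of $0$ in $X$ such that $f_{\mathrm{sing}}(0, x_2) = 0$ for all $x_2 \in U \cap \mathrm{coim}$ and such that the derivative $T_{(0,0)} f_{\mathrm{sing}}: X \to \mathrm{coker}$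 vanishes. Set $f_{\mathrm{NF}}(x_1,x_2) = \hat f(x_2) + f_{\mathrm{sing}}(x_1,x_2)$ for $(x_1,x_2) \in U \subseteq \mathrm{ker} \oplus \mathrm{coim}$, so $f_{\mathrm{NF}}: X \supseteq U \to Y$. A smooth map $f: M \to N$ can be brought into the normal form $(X, Y, \hat f, f_{\mathrm{sing}})$ at $m \in M$ if there exist charts $\kappa: M \supseteq U' \to U \subseteq X$ at $m$ and $\rho: N \supseteq V' \to V \subseteq Y$ at $f(m)$ such that $f(U') \subseteq V'$, $f_{\mathrm{sing}}$ is defined on $U$ and $\rho \circ f|_{U'} \circ \kappa^{-1} = f_{\mathrm{NF}}$. It can be brought into a normal form at $m$ if this holds for some abstract normal form. *)

(* Defs.v *)
From HB Require Import structures.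
From mathcomp Require Import all_boot all_order all_algebra.
From mathcomp Require Import all_classical all_reals all_analysis.

Set Implicit Arguments.
Unset Strict Implicit.
Unset Printing Implicit Defensive.

Import Order.TTheory GRing.Theory Num.Theory.
Import numFieldNormedType.Exports.

Local Open Scope classical_set_scope.
Local Open Scope ring_scope.

(* Locally convex spaces are Hausdorff: [tvsType R] is locally convex but not
   necessarily separated, so [hausdorff_space] is required wherever a locally
   convex space is introduced below. *)

(** * Michal--Bastiani calculus *)

(* The directional derivatives [derivable] and [derive] of the library are
   restricted to normed modules. As [F] is Hausdorff, [gderive f x v] is the
   limit of the difference quotients when it exists; it is 0 otherwise. *)
Section DirectionalDerivative.
Context {R : realType} {E F : tvsType R}.

Definition diff_quotient (f : E -> F) (x v : E) (t : R) : F :=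
  t^-1 *: (f (x + t *: v) - f x).

Definition gderivable (f : E -> F) (x v : E) : Prop :=
  exists l : F, diff_quotient f x v @ 0^' --> l.

Definition gderive (f : E -> F) (x v : E) : F :=
  xget 0 [set l : F | diff_quotient f x v @ 0^' --> l].

End DirectionalDerivative.

(* A map defined on an open set [U] of [E] is a total function on [E] whose
   values outside [U] are irrelevant. It is C^(n+1) when it is continuous, all
   its directional derivatives exist, and df : U x E -> F is C^n. *)
Fixpoint Ck_on {R : realType} (n : nat) (E F : tvsType R)
    (U : set E) (f : E -> F) {struct n} : Prop :=
  {in U, continuous f} /\
  if n is n'.+1 then
    (forall x v, U x -> gderivable f x v) /\
    @Ck_on R n' (E * E)%type F (U `*` setT) (fun p => gderive f p.1 p.2)
  else True.

Definition smooth_on {R : realType} (E F : tvsType R)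
  (U : set E) (f : E -> F) : Prop := forall n, Ck_on n U f.

(** * Manifolds *)

Record chart (R : realType) (M : topologicalType) (X : tvsType R) := Chart {
  chart_dom : set M ;
  chart_cod : set X ;
  chart_map : M -> X ;
  chart_inv : X -> M ;
  chart_dom_open : open chart_dom ;
  chart_cod_open : open chart_cod ;
  chart_mapP : forall m, chart_dom m -> chart_cod (chart_map m) ;
  chart_invP : forall x, chart_cod x -> chart_dom (chart_inv x) ;
  chart_mapK : forall m, chart_dom m -> chart_inv (chart_map m) = m ;
  chart_invK : forall x, chart_cod x -> chart_map (chart_inv x) = x ;
  chart_map_continuous : {in chart_dom, continuous chart_map} ;
  chart_inv_continuous : {in chart_cod, continuous chart_inv} }.

(* The transition map is defined on the image under [phi] of the intersection
   of both chart domains. *)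
Definition smooth_transition (R : realType) (M : topologicalType)
    (X Y : tvsType R) (phi : chart M X) (psi : chart M Y) : Prop :=
  smooth_on [set x | chart_cod phi x /\ chart_dom psi (chart_inv phi x)]
            (chart_map psi \o chart_inv phi).

(* The model space may vary from chart to chart. *)
Record manifold (R : realType) := Manifold {
  mfd_space :> topologicalType ;
  mfd_hausdorff : hausdorff_space mfd_space ;
  mfd_index : Type ;
  mfd_model : mfd_index -> tvsType R ;
  mfd_model_hausdorff : forall i, hausdorff_space (mfd_model i) ;
  mfd_chart : forall i, chart mfd_space (mfd_model i) ;
  mfd_cover : forall m, exists i, chart_dom (mfd_chart i) m ;
  mfd_compat : forall i j, smooth_transition (mfd_chart i) (mfd_chart j) }.

Arguments mfd_model {R} _ _.
Arguments mfd_chart {R} _ _.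

(* Membership in the maximal atlas. *)
Definition compatible_chart (R : realType) (M : manifold R) (X : tvsType R)
    (kappa : chart M X) : Prop :=
  forall i, smooth_transition kappa (mfd_chart M i) /\
            smooth_transition (mfd_chart M i) kappa.

Definition centered_chart (R : realType) (M : manifold R) (X : tvsType R)
    (kappa : chart M X) (m : M) : Prop :=
  [/\ compatible_chart kappa, chart_dom kappa m & chart_map kappa m = 0].

(* A Banach space is a locally convex space whose topology comes from a
   complete norm. *)
Definition banach_space (R : realType) (E : tvsType R) : Prop :=
  exists (B : completeNormedModType R) (phi : {linear B -> E}) (psi : E -> B),
    [/\ cancel phi psi, cancel psi phi, continuous phi & continuous psi].

Definition finite_dimensional (R : realType) (E : tvsType R) : Prop :=
  exists (n : nat) (e : 'I_n -> E),
    forall x, exists c : 'I_n -> R, x = \sum_(i < n) c i *: e i.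

Definition banach_manifold (R : realType) (M : manifold R) : Prop :=
  forall i, banach_space (mfd_model M i).

Definition finite_dimensional_manifold (R : realType) (M : manifold R) : Prop :=
  forall i, finite_dimensional (mfd_model M i).

Definition smooth_map (R : realType) (M N : manifold R) (f : M -> N) : Prop :=
  continuous f /\
  forall (i : mfd_index M) (j : mfd_index N),
    let phi := mfd_chart M i in let psi := mfd_chart N j in
    smooth_on [set x | chart_cod phi x /\ chart_dom psi (f (chart_inv phi x))]
              (chart_map psi \o f \o chart_inv phi).

(** * Tangent spaces *)

(* A tangent vector at [m] is given by its components in one fixed chart of the
   atlas around [m]; another chart gives a space that is identified with this
   one by the derivative of the transition map, a linear homeomorphism. *)
Definition tangent_index (R : realType) (M : manifold R) (m : M) : mfd_index M :=
  projT1 (cid (mfd_cover m)).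

Definition tangent_space (R : realType) (M : manifold R) (m : M) : tvsType R :=
  mfd_model M (tangent_index m).

Definition tangent_map (R : realType) (M N : manifold R) (f : M -> N) (m : M) :
    tangent_space m -> tangent_space (f m) :=
  let phi := mfd_chart M (tangent_index m) in
  let psi := mfd_chart N (tangent_index (f m)) in
  gderive (chart_map psi \o f \o chart_inv phi) (chart_map phi m).

Arguments tangent_map {R M N} f m _.

(** * Regular operators *)

Section Regular.
Context {R : realType}.

Definition linear_subspace (X : tvsType R) (A : set X) : Prop :=
  A 0 /\ forall (a : R) x y, A x -> A y -> A (a *: x + y).

(* [X = A (+) B] topologically: addition A x B -> X, which is continuous, is a
   bijection whose inverse [x |-> (pA x, pB x)] is continuous. *)
Definition topological_sum (X : tvsType R) (A B : set X) : Prop :=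
  [/\ linear_subspace A, linear_subspace B, A `&` B = [set 0] &
      exists pA pB : X -> X,
        [/\ continuous pA, continuous pB &
            forall x, [/\ A (pA x), B (pB x) & x = pA x + pB x]]].

Definition topologically_complemented (X : tvsType R) (A : set X) : Prop :=
  exists B : set X, topological_sum A B.

Definition relatively_open (X Y : topologicalType) (T : X -> Y) : Prop :=
  forall U, open U -> exists2 V, open V & T @` U = V `&` range T.

Definition regular_operator (X Y : tvsType R) (T : X -> Y) : Prop :=
  let ker := T @^-1` [set 0] in
  [/\ linear T, continuous T, relatively_open T,
      closed ker /\ topologically_complemented ker &
      closed (range T) /\ topologically_complemented (range T)].

End Regular.

(** * Normal forms *)

(* [nf_hat] and [nf_sing] are total functions that are only relevant on
   [nf_coim] and on [nf_dom]. As [nf_coker] is closed in [nf_Y], a map into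
   [nf_Y] with values in [nf_coker] is smooth if and only if it is smooth as a
   map into [nf_coker]. *)
Record normal_form (R : realType) := NormalForm {
  nf_X : tvsType R ;
  nf_Y : tvsType R ;
  nf_X_hausdorff : hausdorff_space nf_X ;
  nf_Y_hausdorff : hausdorff_space nf_Y ;
  nf_ker : set nf_X ;
  nf_coim : set nf_X ;
  nf_coker : set nf_Y ;
  nf_im : set nf_Y ;
  nf_X_sum : topological_sum nf_ker nf_coim ;
  nf_Y_sum : topological_sum nf_coker nf_im ;
  nf_hat : nf_X -> nf_Y ;
  nf_hat_linear : forall (a : R) x y, nf_coim x -> nf_coim y ->
    nf_hat (a *: x + y) = a *: nf_hat x + nf_hat y ;
  nf_hat_bij : set_bij nf_coim nf_im nf_hat ;
  nf_hat_continuous : {within nf_coim, continuous nf_hat} ;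
  nf_hat_inv_continuous : exists2 g : nf_Y -> nf_X,
    {in nf_coim, cancel nf_hat g} & {within nf_im, continuous g} ;
  nf_dom : set nf_X ;
  nf_dom_open : open nf_dom ;
  nf_dom0 : nf_dom 0 ;
  nf_sing : nf_X -> nf_Y ;
  nf_sing_coker : forall x, nf_dom x -> nf_coker (nf_sing x) ;
  nf_sing_smooth : smooth_on nf_dom nf_sing ;
  nf_sing_coim : forall x2, nf_dom x2 -> nf_coim x2 -> nf_sing x2 = 0 ;
  nf_sing_derive : forall v, gderive nf_sing 0 v = 0 }.

Arguments nf_ker {R} _ _.
Arguments nf_coim {R} _ _.
Arguments nf_coker {R} _ _.
Arguments nf_im {R} _ _.
Arguments nf_hat {R} _ _.
Arguments nf_dom {R} _ _.
Arguments nf_sing {R} _ _.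

(* The last clause says that rho o f o kappa^-1 = f_NF on [chart_cod kappa],
   where f_NF (x1 + x2) = nf_hat x2 + nf_sing (x1 + x2). *)
Definition brought_into (R : realType) (M N : manifold R) (f : M -> N) (m : M)
    (nf : normal_form R) : Prop :=
  exists (kappa : chart M (nf_X nf)) (rho : chart N (nf_Y nf)),
    [/\ centered_chart kappa m, centered_chart rho (f m),
        f @` chart_dom kappa `<=` chart_dom rho,
        chart_cod kappa `<=` nf_dom nf &
        forall x1 x2, nf_ker nf x1 -> nf_coim nf x2 ->
          chart_cod kappa (x1 + x2) ->
          chart_map rho (f (chart_inv kappa (x1 + x2))) =
            nf_hat nf x2 + nf_sing nf (x1 + x2)].

Definition has_normal_form (R : realType) (M N : manifold R) (f : M -> N)
    (m : M) : Prop := exists nf : normal_form R, brought_into f m nf.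

(* Main.v *)
Require Import Defs.
From HB Require Import structures.
From mathcomp Require Import all_boot all_order all_algebra.
From mathcomp Require Import all_classical all_reals all_analysis.
From mathcomp Require Import ring lra.

(** Let F be the local representative of f in charts centered at m and f(m), and
    T = F'(0). Regularity of T amounts to the existence of a continuous linear
    S with TST = T and STS = S; then ST and 1 - ST project onto coim and ker,
    TS and 1 - TS onto im and coker. In a normal form the derivative at 0 is
    the extension of [nf_hat] by 0 on ker, which has such an S, and the
    derivatives of the changes of charts are isomorphisms. Conversely, given S,
    the map x - ST x + S F(x) has derivative 1 at 0, and on a Banach space it is
    a local diffeomorphism; with G := F o (its inverse) one gets SG = ST, so that
    G = T + g with Sg = 0. The diffeomorphism y - g(S y) of Y then turns G into
    z |-> T z + (g(z) - g(S T z)).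
    The inverse function theorem for Michal--Bastiani smooth maps is a
    contraction argument: fixed points of contractions depend smoothly on
    parameters, since the derivative of the fixed point is itself the fixed point
    of a contraction. If dim M < oo, then S exists for every T by Hahn--Banach
    applied in Y. *)

Set Implicit Arguments.
Unset Strict Implicit.
Unset Printing Implicit Defensive.

Import Order.TTheory GRing.Theory Num.Theory.
Import numFieldNormedType.Exports.

Local Open Scope classical_set_scope.
Local Open Scope ring_scope.

(** * Locally convex spaces and directional derivatives *)

(** The model space Y of N carries no norm and need not be complete, so no equation can be solved in
    it by iteration. All solving is done in the Banach model of M, and the diffeomorphism of Y is
    explicit: since S g = 0, the maps y - g(S y) and y + g(S y) invert each other. For the same
    reason no open mapping theorem applies to T, and relative openness is what makes S continuous.
    The definition of C^1 asks only for directional derivatives that are jointly continuous in point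
    and direction. Linearity in the direction and the chain rule must be derived, from a mean value
    theorem in which convex neighbourhoods replace norms. The tangent map is read in atlas charts
    picked by choice. From a normal form to regularity it is compared with the given charts through
    derivatives of transition maps; in the other direction the charts are built from those very
    atlas charts. *)

Lemma pair_continuous (S T U : topologicalType) (f : S -> T) (g : S -> U) :
  continuous f -> continuous g -> continuous (fun x => (f x, g x)).
Proof. by move=> cf cg x; apply: cvg_pair; [exact: cf|exact: cg]. Qed.

Lemma comp_continuous (S T U : topologicalType) (f : S -> T) (g : T -> U) :
  continuous f -> continuous g -> continuous (fun x => g (f x)).
Proof. by move=> cf cg x; apply: continuous_comp; [exact: cf|exact: cg]. Qed.

Lemma proj1_continuous (S T : topologicalType) : continuous (@fst S T).
Proof. by move=> x; exact: cvg_fst. Qed.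

Lemma proj2_continuous (S T : topologicalType) : continuous (@snd S T).
Proof. by move=> x; exact: cvg_snd. Qed.

Section LocallyConvex.
Context {R : realType}.
Implicit Types E F : tvsType R.

Lemma tvs_cvgD {T : Type} {FF : set_system T} {FFF : Filter FF} E
    (f g : T -> E) (a b : E) :
  f @ FF --> a -> g @ FF --> b -> (fun x => f x + g x) @ FF --> a + b.
Proof. by move=> fa gb; apply: (cvg_comp2 fa gb); exact: (add_continuous (a, b)). Qed.

Lemma tvs_cvgN {T : Type} {FF : set_system T} {FFF : Filter FF} E
    (f : T -> E) (a : E) :
  f @ FF --> a -> (fun x => - f x) @ FF --> - a.
Proof. by move=> fa; apply: (cvg_comp _ _ fa); exact: opp_continuous. Qed.

Lemma tvs_cvgB {T : Type} {FF : set_system T} {FFF : Filter FF} E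
    (f g : T -> E) (a b : E) :
  f @ FF --> a -> g @ FF --> b -> (fun x => f x - g x) @ FF --> a - b.
Proof. by move=> fa gb; apply: tvs_cvgD => //; exact: tvs_cvgN. Qed.

Lemma tvs_cvgZ {T : Type} {FF : set_system T} {FFF : Filter FF} E
    (r : T -> R) (g : T -> E) (a : R) (b : E) :
  r @ FF --> a -> g @ FF --> b -> (fun x => r x *: g x) @ FF --> a *: b.
Proof.
move=> fa gb; apply: (cvg_comp2 fa gb).
exact: (@scale_continuous R E (a, b)).
Qed.

Definition convex_subset E (A : set E) : Prop :=
  forall a b (l : R), A a -> A b -> 0 <= l <= 1 -> A (l *: a + (1 - l) *: b).

Lemma convex_nbhs E (x : E) (U : set E) : nbhs x U ->
  exists V, [/\ open V, V x, V `<=` U & convex_subset V].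
Proof.
move=> xU; have [B Bc [Bo Bb]] := @locally_convex R E.
have [V [BV Vx] VU] := Bb x U xU.
exists V; split => //; first exact: Bo.
move=> a b l Va Vb /andP[l0 l1].
have := Bc V (mem_set BV) a b (Itv01 l0 l1) (mem_set Va) (mem_set Vb).
by move/set_mem.
Qed.

Lemma hausdorff_prod (S T : topologicalType) :
  hausdorff_space S -> hausdorff_space T -> hausdorff_space (S * T)%type.
Proof.
move=> hS hT [p1 p2] [q1 q2] pq; congr pair.
  apply: hS => A B pA qB.
  have [|//|[a b] [/= [Aa _] [Ba _]]] := pq (A `*` setT) (B `*` setT).
  - by exists (A, setT) => //; split=> //; exact: filterT.
  - by exists (B, setT) => //; split=> //; exact: filterT.
  by exists a.
apply: hT => A B pA qB.
have [|//|[a b] [/= [_ Aa] [_ Ba]]] := pq (setT `*` A) (setT `*` B).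
- by exists (setT, A) => //; split=> //; exact: filterT.
- by exists (setT, B) => //; split=> //; exact: filterT.
by exists b.
Qed.

Lemma diff_quotientB E F (f g : E -> F) x v :
  diff_quotient (fun y => f y - g y) x v =
  fun t => diff_quotient f x v t - diff_quotient g x v t.
Proof.
apply/funext => t; rewrite /diff_quotient -scalerBr; congr (_ *: _).
by rewrite !opprD !opprK !addrA; congr (_ + _); rewrite addrAC.
Qed.

Lemma diff_quotient_unique E F (f : E -> F) x v l :
  hausdorff_space F -> diff_quotient f x v @ 0^' --> l -> gderive f x v = l.
Proof.
move=> hF fl; rewrite /gderive.
case: xgetP => [y _ yl|/(_ l)//].
exact: (cvg_unique hF yl fl).
Qed.

Lemma gderivableP E F (f : E -> F) x v :
  gderivable f x v -> diff_quotient f x v @ 0^' --> gderive f x v.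
Proof. by move=> [l fl]; rewrite /gderive; case: xgetP => // /(_ l). Qed.

Lemma near_line E (x v : E) (U : set E) : nbhs x U ->
  \forall t \near (0 : R), U (x + t *: v).
Proof.
move=> xU; have : (fun t : R => x + t *: v) @ (0 : R) --> x.
  rewrite -[X in _ --> X]addr0 -[X in _ --> _ + X](scale0r v).
  by apply: tvs_cvgD; [exact: cvg_cst|apply: tvs_cvgZ; [exact: cvg_id|exact: cvg_cst]].
exact.
Qed.

Lemma diff_quotient_near E F (f g : E -> F) (x v : E) (l : F) :
  (\forall y \near x, f y = g y) ->
  diff_quotient f x v @ 0^' --> l -> diff_quotient g x v @ 0^' --> l.
Proof.
move=> fg; apply: cvg_trans; apply: near_eq_cvg.
apply: nbhs_dnbhs; have := near_line v fg; apply: filterS => t /= e.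
by rewrite /diff_quotient e (nbhs_singleton fg).
Qed.

Lemma gderivable_near E F (f g : E -> F) (x v : E) :
  (\forall y \near x, f y = g y) -> gderivable f x v -> gderivable g x v.
Proof. by move=> fg [l fl]; exists l; apply: diff_quotient_near fl. Qed.

Lemma gderive_near E F (f g : E -> F) (x v : E) :
  (\forall y \near x, f y = g y) -> gderive f x v = gderive g x v.
Proof.
move=> fg; rewrite /gderive; congr xget; apply/seteqP; split => l /=.
  exact: diff_quotient_near.
by apply: diff_quotient_near; apply: filterS fg => y ->.
Qed.

Lemma gderive0 E F (f : E -> F) x : hausdorff_space F -> gderive f x 0 = 0.
Proof.
move=> hF; apply: diff_quotient_unique => //.
rewrite (_ : diff_quotient f x 0 = cst 0); first exact: cvg_cst.
by apply/funext => t; rewrite /diff_quotient scaler0 addr0 subrr scaler0.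
Qed.

(** Replacing [t] by [t * r] rescales the quotient. Homogeneity thus holds for a single directional
    derivative, whereas additivity will use C^1. *)
Lemma gderiveZ E F (f : E -> F) x v (r : R) : hausdorff_space F ->
  gderivable f x v ->
  diff_quotient f x (r *: v) @ 0^' --> r *: gderive f x v.
Proof.
move=> hF fxv; have [->|r0] := eqVneq r 0.
  rewrite !scale0r (_ : diff_quotient f x 0 = cst 0); first exact: cvg_cst.
  by apply/funext => t; rewrite /diff_quotient scaler0 addr0 subrr scaler0.
have -> : diff_quotient f x (r *: v) =
    (fun t => r *: (diff_quotient f x v \o (fun t => t * r)) t).
  apply/funext => t; rewrite /diff_quotient /= !scalerA invfM mulrCA mulfV//.
  by rewrite mulr1.
apply: tvs_cvgZ; first exact: cvg_cst.
apply: (@cvg_comp _ _ _ (fun t : R => t * r) _ _ 0^'); last exact: gderivableP.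
have : (fun t : R => t * r) @ 0^' --> (0 * r)^'.
  apply: continuous_injective_withinNx => [|y /(mulIf r0)//].
  by apply: cvgM; [exact: cvg_id|exact: cvg_cst].
by rewrite mul0r.
Qed.

End LocallyConvex.

(** * Mean value theorem and chain rule *)

Section MeanValue.
Context {R : realType}.
Implicit Types E F : tvsType R.

(** Call a chord good if its slope lies in [C]. Convexity glues good chords over adjacent intervals,
    the derivative makes short chords ending at a given point good, and a supremum argument then
    reaches 1 from 0. *)
Lemma mean_value F (g g' : R -> F) (C : set F) : convex_subset C ->
  (forall s, 0 <= s <= 1 ->
     (fun t => t^-1 *: (g (s + t) - g s)) @ 0^' --> g' s) ->
  (forall s, 0 <= s <= 1 -> nbhs (g' s) C) -> C (g 1 - g 0).
Proof.
move=> Cc dg Cg'.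
(* Stated as a product, so that it also makes sense for [a = b], where any point of [C] serves as
   [c]. *)
pose P a b := exists2 c, C c & g b - g a = (b - a) *: c.
have Ptrans a b c : a <= b -> b <= c -> P a b -> P b c -> P a c.
  move=> ab bc [u Cu uE] [v Cv vE].
  have [ac|ac] := eqVneq a c.
    have ba : b = a by apply/eqP; rewrite eq_le ab {1}ac bc.
    by subst b c; exists u.
  have ca0 : 0 < c - a by rewrite subr_gt0 lt_neqAle ac (le_trans ab bc).
  exists (((b - a) / (c - a)) *: u + (1 - (b - a) / (c - a)) *: v).
    apply: Cc => //; apply/andP; split; first by rewrite divr_ge0 ?subr_ge0// ltW// -subr_gt0.
    by rewrite ler_pdivrMr// mul1r; lra.
  have -> : g c - g a = (g c - g b) + (g b - g a) by rewrite addrA subrK.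
  rewrite uE vE scalerDr !scalerA addrC; congr (_ *: _ + _ *: _).
    by rewrite mulrC divfK// gt_eqF.
  by field; rewrite gt_eqF.
have Ploc s : 0 <= s <= 1 -> exists2 d, 0 < d &
    forall a b, s - d < a -> a <= s -> s <= b -> b < s + d -> P a s /\ P s b.
  move=> s01; have := dg s s01 C (Cg' s s01).
  rewrite /= => /nbhs_ballP[d /= d0 Hd]; exists d => // a b sa as_ sb bs.
  have [c0 Cc0] : C !=set0 by exists (g' s); exact: nbhs_singleton (Cg' s s01).
  split.
    have [->|nas] := eqVneq a s; first by exists c0 => //; rewrite !subrr scale0r.
    exists ((a - s)^-1 *: (g (s + (a - s)) - g s)).
      apply: Hd; last by rewrite subr_eq0.
      by rewrite /ball/= sub0r normrN ltr_norml; apply/andP; split; lra.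
    rewrite scalerA -[s - a]opprB mulNr mulfV ?subr_eq0// scaleN1r opprB.
    by rewrite subrKC.
  have [->|nas] := eqVneq b s; first by exists c0 => //; rewrite !subrr scale0r.
  exists ((b - s)^-1 *: (g (s + (b - s)) - g s)).
    apply: Hd; last by rewrite subr_eq0.
    by rewrite /ball/= sub0r normrN ltr_norml; apply/andP; split; lra.
  rewrite scalerA mulfV ?subr_eq0// scale1r.
  by rewrite subrKC.
pose A := [set t | 0 <= t <= 1 /\ P 0 t].
have A0 : A 0.
  split; first by rewrite lexx ler01.
  exists (g' 0); last by rewrite !subrr scale0r.
  by apply: nbhs_singleton; apply: Cg'; rewrite lexx ler01.
have hA : has_sup A.
  by split; [exists 0|exists 1 => t [/andP[]]].
have s01 : 0 <= sup A <= 1.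
  rewrite ub_le_sup//=; last by case: hA.
  by apply: ge_sup; [exists 0|move=> t [/andP[]]].
have [d d0 Hd] := Ploc _ s01.
have [t At ts] := sup_adherent d0 hA.
have tsup : t <= sup A by apply: ub_le_sup => //; case: hA.
have [|Pts _] := Hd t (sup A) ts tsup (lexx _); first by rewrite ltrDl.
have P0s : P 0 (sup A).
  by case: At => /andP[t0 _] P0t; exact: (Ptrans _ t).
have [s1|s1] := eqVneq (sup A) 1.
  by move: P0s; rewrite s1 => -[c Cc' ->]; rewrite subr0 scale1r.
have lts1 : sup A < 1 by rewrite lt_neqAle s1; case/andP: s01.
(* A point of [0, 1] beyond the supremum and still within reach of the local property: the
   contradiction. *)
pose b := Num.min 1 (sup A + d / 2).
have sb : sup A < b by rewrite /b lt_min lts1 ltrDl divr_gt0.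
have bd : b < sup A + d by rewrite /b gt_min; apply/orP; right; lra.
have [|_ Psb] := Hd (sup A) b _ (lexx _) (ltW sb) bd; first by lra.
have Ab : A b.
  split; first by rewrite /b ge_min lexx orTb andbT -/b; case/andP: s01; lra.
  by apply: (Ptrans _ (sup A)) => //; [case/andP: s01|exact: ltW].
suff : b <= sup A by rewrite leNgt sb.
by apply: ub_le_sup => //; case: hA.
Qed.

Lemma segment_mean_value E F (f : E -> F) (x v : E) (C : set F) :
  convex_subset C ->
  (forall s, 0 <= s <= 1 -> gderivable f (x + s *: v) v) ->
  (forall s, 0 <= s <= 1 -> nbhs (gderive f (x + s *: v) v) C) ->
  C (f (x + v) - f x).
Proof.
move=> Cc df Cdf.
have := @mean_value F (fun s => f (x + s *: v)) (fun s => gderive f (x + s *: v) v) C Cc.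
rewrite scale1r scale0r addr0; apply => // s /df /gderivableP.
rewrite /diff_quotient (_ : (fun t => _) = (fun t : R =>
  t^-1 *: (f (x + (s + t) *: v) - f (x + s *: v))))//.
by apply/funext => t; rewrite scalerDl addrA.
Qed.

End MeanValue.

(** * Consequences of the joint continuity of the differential *)

Section C1.
Context {R : realType}.
Implicit Types E F G : tvsType R.

Lemma Ck_continuous E F n (U : set E) (f : E -> F) :
  Ck_on n U f -> {in U, continuous f}.
Proof. by case: n => [[]|n []]. Qed.

(* Hadamard differentiability, uniformly in the base point. *)
Lemma C1_diff_quotient_cvg E F (U : set E) (f : E -> F) (T : Type)
    (FF : set_system T) (x_ v_ : T -> E) (t_ : T -> R) (x v : E) :
  Filter FF -> hausdorff_space F -> open U -> Ck_on 1 U f -> U x ->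
  x_ @ FF --> x -> v_ @ FF --> v -> t_ @ FF --> (0 : R) ->
  (\forall i \near FF, t_ i != 0) ->
  (fun i => (t_ i)^-1 *: (f (x_ i + t_ i *: v_ i) - f (x_ i))) @ FF -->
    gderive f x v.
Proof.
move=> FFF hF oU [cf [df [cdf _]]] Ux xx vv t0 tn0 O.
move=> /convex_nbhs [C [oC Cl CO Cc]].
have /= := cdf (x, v); rewrite inE => /(_ (conj Ux I)) /(_ C).
case=> [|[A B] [/= xA vB] AB]; first exact: open_nbhs_nbhs.
have : nbhs x (A `&` U) by apply: filterI => //; exact: open_nbhs_nbhs.
move=> /convex_nbhs [W [oW Wx WAU Wc]].
have xtv : (fun i => x_ i + t_ i *: v_ i) @ FF --> x.
  rewrite -[X in _ --> X]addr0 -[X in _ --> _ + X](scale0r v).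
  by apply: tvs_cvgD => //; exact: tvs_cvgZ.
have xW : nbhs x W by exact: open_nbhs_nbhs.
suff : \forall i \near FF, C ((t_ i)^-1 *: (f (x_ i + t_ i *: v_ i) - f (x_ i))).
  by apply: filterS => i /CO.
near=> i.
have ti0 : t_ i != 0 by near: i.
have Wi : W (x_ i) by near: i; exact: xx.
have Wi' : W (x_ i + t_ i *: v_ i) by near: i; exact: xtv.
have Bi : B (v_ i) by near: i; exact: vv.
have Ws s : 0 <= s <= 1 -> W (x_ i + s *: (t_ i *: v_ i)).
  move=> s01; have := Wc _ _ s Wi' Wi s01.
  by rewrite scalerDr scalerBl scale1r addrAC subrKC.
(* Dividing by [t_ i] beforehand makes the derivative of [g] that of [f] in the direction [v_ i],
   which stays in [B]; the slope over [0, 1] is the quotient to be estimated. *)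
pose g s := (t_ i)^-1 *: f (x_ i + s *: (t_ i *: v_ i)).
rewrite (_ : _ *: _ = g 1 - g 0); last by rewrite /g scale1r scale0r addr0 scalerBr.
apply: (@mean_value _ _ _ (fun s => gderive f (x_ i + s *: (t_ i *: v_ i)) (v_ i))) => //.
  move=> s s01; have [_ Us] := WAU _ (Ws s s01).
  have -> : (fun t => t^-1 *: (g (s + t) - g s)) = (fun t => (t_ i)^-1 *:
      diff_quotient f (x_ i + s *: (t_ i *: v_ i)) (t_ i *: v_ i) t).
    apply/funext => t; rewrite /diff_quotient /g -scalerBr scalerDl addrA.
    by rewrite !scalerA [t^-1 * _]mulrC.
  have := @gderiveZ R E F f _ (v_ i) (t_ i) hF (df _ _ Us).
  by move=> /(tvs_cvgZ (cvg_cst (t_ i)^-1)); rewrite scalerA mulVf// scale1r.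
move=> s s01; have [As Us] := WAU _ (Ws s s01).
apply: open_nbhs_nbhs; split => //.
exact: (AB (_, _)).
Unshelve. all: by end_near. Qed.

(** With q(t) the difference quotient of [f], one has f(x + t v) = f(x) + t q(t), so the quotient of
    the composite is one of [g] along the converging directions q(t). Of [f] only this one
    directional derivative is used. *)
Lemma gderive_comp E F G (V : set F) (f : E -> F) (g : F -> G) (x v : E) :
  hausdorff_space F -> hausdorff_space G -> open V -> Ck_on 1 V g -> V (f x) ->
  gderivable f x v ->
  diff_quotient (g \o f) x v @ 0^' --> gderive g (f x) (gderive f x v).
Proof.
move=> hF hG oV g1 Vfx /gderivableP fxv.
have id0 : (id : R -> R) @ 0^' --> (0 : R) by exact: nbhs_dnbhs.
have n0 : \forall i \near (0 : R)^', i != 0 by exact: nbhs_dnbhs_neq.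
have c0 : cst (f x) @ (0 : R)^' --> f x by exact: cvg_cst.
have F0 : Filter (0 : R)^' by exact: within_filter.
have := C1_diff_quotient_cvg F0 hG oV g1 Vfx c0 fxv id0 n0.
move=> h; apply: (cvg_trans _ h); apply: near_eq_cvg; near=> t.
have t0 : t != 0 by near: t.
by rewrite /diff_quotient scalerA mulfV// scale1r subrKC.
Unshelve. all: by end_near. Qed.

(** For additivity the increment along t (v + w) is split at x + t v. The second piece has a base
    point moving with t, which is where the uniform form of the derivative enters. *)
Lemma gderive_linear E F (U : set E) (f : E -> F) (x : E) :
  hausdorff_space F -> open U -> Ck_on 1 U f -> U x -> linear (gderive f x).
Proof.
move=> hF oU f1 Ux a v w; have [cf [df _]] := f1.
have -> : a *: gderive f x v = gderive f x (a *: v).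
  by apply/esym/diff_quotient_unique => //; apply: gderiveZ => //; exact: df.
move: (a *: v) => {}v; rewrite [v + w]addrC [RHS]addrC; apply: diff_quotient_unique => //.
have id0 : (id : R -> R) @ 0^' --> (0 : R) by exact: nbhs_dnbhs.
have n0 : \forall i \near (0 : R)^', i != 0 by exact: nbhs_dnbhs_neq.
have xv : (fun t => x + t *: v) @ 0^' --> x.
  rewrite -[X in _ --> X]addr0 -[X in _ --> _ + X](scale0r v).
  by apply: tvs_cvgD; [exact: cvg_cst|apply: tvs_cvgZ => //; exact: cvg_cst].
have c0 : cst w @ (0 : R)^' --> w by exact: cvg_cst.
have F0 : Filter (0 : R)^' by exact: within_filter.
have := C1_diff_quotient_cvg F0 hF oU f1 Ux xv c0 id0 n0.
move=> /tvs_cvgD /(_ (gderivableP (df x v Ux))).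
rewrite [X in X @ _](_ : _ = diff_quotient f x (w + v))//; apply/funext => t.
by rewrite /diff_quotient -scalerDr addrA subrK [t *: (w + v)]scalerDr [t *: w + _]addrC addrA.
Qed.

End C1.

(** * Closure properties of C^k maps *)

Section CkClosure.
Context {R : realType}.
Implicit Types E F G H : tvsType R.

Lemma openX (S T : topologicalType) (U : set S) (V : set T) :
  open U -> open V -> open (U `*` V).
Proof.
move=> oU oV; apply: openI; apply: open_comp => // p _.
- exact: cvg_fst.
- exact: cvg_snd.
Qed.

Lemma openXT E F (U : set E) : open U -> open (U `*` [set: F]).
Proof. by move=> oU; apply: openX => //; exact: openT. Qed.

Lemma Ck_sub E F n (U V : set E) (f : E -> F) :
  V `<=` U -> Ck_on n U f -> Ck_on n V f.
Proof.
elim: n => [|n IH] in E U V f * => VU /=.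
  by move=> [cf _]; split=> // x /set_mem/VU/mem_set; exact: cf.
move=> [cf [df Cf]]; split; first by move=> x /set_mem/VU/mem_set; exact: cf.
split; first by move=> x v /VU; exact: df.
by apply: IH Cf => -[x v] [/= /VU ? ?]; split.
Qed.

Lemma CkW E F n (U : set E) (f : E -> F) : Ck_on n.+1 U f -> Ck_on n U f.
Proof.
elim: n => [|n IH] in E U f *; first by case.
by move=> [cf [df Cf]]; split => //; split => //; exact: IH.
Qed.

Lemma open_near_eq E F (U : set E) (f g : E -> F) x :
  open U -> {in U, f =1 g} -> U x -> \forall y \near x, f y = g y.
Proof.
move=> oU fg Ux; have : nbhs x U by exact: open_nbhs_nbhs.
by apply: filterS => y /mem_set; exact: fg.
Qed.

Lemma Ck_eq E F n (U : set E) (f g : E -> F) :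
  open U -> {in U, f =1 g} -> Ck_on n U f -> Ck_on n U g.
Proof.
elim: n => [|n IH] in E U f g * => oU fg [cf].
  move=> _; split=> // x xU; have Ux := set_mem xU.
  rewrite /continuous_at -(fg x xU); apply: cvg_trans (cf x xU).
  by apply: near_eq_cvg; exact: open_near_eq Ux.
move=> [df Cf]; split.
  move=> x xU; have Ux := set_mem xU.
  rewrite /continuous_at -(fg x xU); apply: cvg_trans (cf x xU).
  by apply: near_eq_cvg; exact: open_near_eq Ux.
split=> [x v Ux|].
  by apply: gderivable_near (df x v Ux); exact: open_near_eq Ux.
apply: IH Cf; first exact: openXT.
move=> [x v] /set_mem [/= Ux _]; apply: gderive_near; exact: open_near_eq Ux.
Qed.

Lemma Ck_pair E F G n (U : set E) (f : E -> F) (g : E -> G) :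
  hausdorff_space F -> hausdorff_space G -> open U ->
  Ck_on n U f -> Ck_on n U g -> Ck_on n U (fun x => (f x, g x)).
Proof.
move=> hF hG; elim: n => [|n IH] in E U f g * => oU [cf +] [cg +].
  by move=> _ _; split=> // x xU; apply: cvg_pair; [exact: cf|exact: cg].
move=> [df Cf] [dg Cg]; split.
  by move=> x xU; apply: cvg_pair; [exact: cf|exact: cg].
have dfg x v : U x -> diff_quotient (fun x => (f x, g x)) x v @ 0^' -->
    (gderive f x v, gderive g x v).
  move=> Ux; apply: cvg_pair; apply: gderivableP; [exact: df|exact: dg].
split=> [x v Ux|]; first by eexists; exact: dfg.
apply: Ck_eq (IH _ _ _ _ _ Cf Cg); [exact: openXT| |exact: openXT].
move=> [x v] /set_mem[/= Ux _]; apply/esym/diff_quotient_unique; last exact: dfg.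
exact: hausdorff_prod.
Qed.

Lemma diff_quotient_linear E F (f : E -> F) x v : linear f ->
  diff_quotient f x v @ 0^' --> f v.
Proof.
move=> lf; have : cst (f v) @ (0 : R)^' --> f v by exact: cvg_cst.
move=> h; apply: (cvg_trans _ h); apply: near_eq_cvg; near=> t.
have t0 : t != 0 by near: t; exact: nbhs_dnbhs_neq.
rewrite /diff_quotient [x + _]addrC lf addrK scalerA mulVf// scale1r//.
Unshelve. all: by end_near. Qed.

Lemma Ck_linear E F n (U : set E) (f : E -> F) : hausdorff_space F ->
  linear f -> continuous f -> Ck_on n U f.
Proof.
move=> hF; elim: n => [|n IH] in E U f * => lf cf; first by split=> // x _; exact: cf.
split; first by move=> x _; exact: cf.
split=> [x v _|]; first by exists (f v); exact: diff_quotient_linear.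
have -> : (fun p => gderive f p.1 p.2) = f \o snd.
  apply/funext => p /=; apply: diff_quotient_unique => //.
  exact: diff_quotient_linear.
apply: IH; first by move=> a p q /=; rewrite lf.
by move=> p; apply: continuous_comp; [exact: cvg_snd|exact: cf].
Qed.

Lemma Ck_cst E F n (U : set E) (c : F) : hausdorff_space F ->
  Ck_on n U (fun _ : E => c).
Proof.
move=> hF; elim: n => [|n IH] in E U c *; first by split=> // x _; exact: cvg_cst.
have dc x v : diff_quotient (fun _ : E => c) x v @ 0^' --> (0 : F).
  rewrite (_ : diff_quotient _ x v = cst 0); first exact: cvg_cst.
  by apply/funext => t; rewrite /diff_quotient subrr scaler0.
split; first by move=> x _; exact: cvg_cst.
split=> [x v _|]; first by exists 0.
have -> : (fun p => gderive (fun _ : E => c) p.1 p.2) = (fun=> 0); last exact: IH.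
by apply/funext => p; exact: diff_quotient_unique.
Qed.

(** The differential of the composite is dg after (f o pr1, df), again a composite of maps one class
    lower; hence the induction runs over all spaces and domains. *)
Lemma Ck_comp E F G n (U : set E) (V : set F) (f : E -> F) (g : F -> G) :
  hausdorff_space E -> hausdorff_space F -> hausdorff_space G ->
  open U -> open V -> (forall x, U x -> V (f x)) ->
  Ck_on n U f -> Ck_on n V g -> Ck_on n U (g \o f).
Proof.
elim: n => [|n IH] in E F G U V f g * => hE hF hG oU oV UV.
  move=> [cf _] [cg _]; split => // x xU; apply: continuous_comp.
    exact: cf.
  by apply: cg; apply/mem_set/UV/set_mem.
move=> Cf1 Cg1; have [cf [df Cf]] := Cf1; have [cg [dg Cg]] := Cg1.
split.
  move=> x xU; apply: continuous_comp; first exact: cf.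
  by apply: cg; apply/mem_set/UV/set_mem.
have C1g : Ck_on 1 V g.
  by split=> //; split=> //; split=> //; case: (n) Cg => [[]|m []].
have dfg x v : U x -> diff_quotient (g \o f) x v @ 0^' -->
    gderive g (f x) (gderive f x v).
  by move=> Ux; apply: gderive_comp C1g _ _ => //; [exact: UV|exact: df].
split=> [x v Ux|]; first by eexists; exact: dfg.
apply: (@Ck_eq _ _ _ _ ((fun p => gderive g p.1 p.2) \o
    (fun p => (f p.1, gderive f p.1 p.2)))).
- exact: openXT.
- by move=> [x v] /set_mem[/= Ux _]; apply/esym/diff_quotient_unique => //; exact: dfg.
apply: (IH _ _ _ _ (V `*` setT)) => //.
- exact: hausdorff_prod.
- exact: hausdorff_prod.
- exact: openXT.
- exact: openXT.
- by move=> [x v] [/= Ux _]; split => //=; exact: UV.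
apply: Ck_pair => //; first exact: openXT.
apply: (IH _ _ _ _ U) => //.
- exact: hausdorff_prod.
- exact: openXT.
- by move=> [x v] [].
- apply: Ck_linear => //; move=> x; exact: cvg_fst.
- exact: CkW.
Qed.

Lemma Ck_D E F n (U : set E) (f g : E -> F) :
  hausdorff_space E -> hausdorff_space F -> open U ->
  Ck_on n U f -> Ck_on n U g -> Ck_on n U (fun x => f x + g x).
Proof.
move=> hE hF oU Cf Cg.
apply: (@Ck_comp _ _ _ n U setT (fun x => (f x, g x)) (fun p => p.1 + p.2)) => //.
- exact: hausdorff_prod.
- exact: openT.
- exact: Ck_pair.
apply: Ck_linear => //; last exact: add_continuous.
by move=> a p q /=; rewrite scalerDr addrACA.
Qed.

Lemma Ck_B E F n (U : set E) (f g : E -> F) :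
  hausdorff_space E -> hausdorff_space F -> open U ->
  Ck_on n U f -> Ck_on n U g -> Ck_on n U (fun x => f x - g x).
Proof.
move=> hE hF oU Cf Cg.
apply: (@Ck_comp _ _ _ n U setT (fun x => (f x, g x)) (fun p => p.1 - p.2)) => //.
- exact: hausdorff_prod.
- exact: openT.
- exact: Ck_pair.
apply: Ck_linear => //; last exact: sub_continuous.
by move=> a p q /=; rewrite scalerBr opprD addrACA.
Qed.

End CkClosure.

(** * Smooth dependence of fixed points and inverse functions *)

Section FixedPoint.
Context {R : realType}.

Lemma closed_norm_le (X : normedModType R) (c : R) :
  closed [set z : X | `|z| <= c].
Proof.
apply: (@preimage_closed X R (fun z => `|z|) [set r | r <= c]).
  by move=> x _; exact: norm_continuous.
exact: closed_le.
Qed.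

Lemma contraction_fixed_point (X : completeNormedModType R) (D : set X)
    (k : X -> X) : closed D -> D !=set0 -> (forall x, D x -> D (k x)) ->
  (forall x y, D x -> D y -> `|k x - k y| <= 2^-1 * `|x - y|) ->
  exists2 p, D p & k p = p.
Proof.
move=> cD D0 Dk kl; pose kf : {fun D >-> D} := mkfun Dk.
have [|p Dp pE] := @banach_fixed_point R X D kf _ cD D0; last by exists p.
exists (2^-1)%:nng; split; first by rewrite invf_lt1//= ltr1n.
by move=> [x y] [/= Dx Dy]; exact: kl.
Qed.

(** The constant 2 is 1 / (1 - 1/2): a point is at distance at most twice its displacement from the
    fixed point of a contraction with constant 1/2. *)
Lemma cvg_dist_dominated (X : normedModType R) (T : Type) (FF : set_system T)
    (f g : T -> X) (a b : X) : Filter FF ->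
  (\forall i \near FF, `|f i - a| <= 2 * `|g i - b|) ->
  g @ FF --> b -> f @ FF --> a.
Proof.
move=> FFF fg gb; apply/cvgrPdistC_le => e e0.
have h := @cvgr_distC_le _ _ _ _ FFF _ _ gb (e / 2) (divr_gt0 e0 (ltr0n _ 2)).
apply: filterS2 fg h => i fgi gi.
by apply: (le_trans fgi); rewrite mulrC -ler_pdivlMr.
Qed.

(** The displacement of [s p] under [K (q, _)] tends to 0 as q tends to p, and it controls the
    distance from [s p] to [s q]. *)
Lemma fixed_point_continuous (X : normedModType R) (P : tvsType R) (A : set P)
    (B : set X) (K : P * X -> X) (s : P -> X) :
  open A -> {in A `*` B, continuous K} ->
  (forall p x y, A p -> B x -> B y ->
    `|K (p, x) - K (p, y)| <= 2^-1 * `|x - y|) ->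
  (forall p, A p -> B (s p) /\ K (p, s p) = s p) ->
  {in A, continuous s}.
Proof.
move=> oA cK Kl sP p /set_mem Ap; have [Bs Ks] := sP p Ap.
have cKp : (fun p' => K (p', s p)) @ p --> s p.
  rewrite -[X in _ --> X]Ks.
  apply: (@cvg_comp _ _ _ (fun p' => (p', s p)) K _ (nbhs (p, s p))).
    by apply: cvg_pair; [exact: cvg_id|exact: cvg_cst].
  by apply: cK; exact/mem_set.
apply: cvg_dist_dominated cKp.
have : nbhs p A by exact: open_nbhs_nbhs.
apply: filterS => q Aq; have [Bq Kq] := sP q Aq.
have := Kl q (s q) (s p) Aq Bq Bs; rewrite Kq.
have := ler_normD (s q - K (q, s p)) (K (q, s p) - s p).
by rewrite addrA subrK; lra.
Qed.

(* The derivative [ds (p, w)] of the fixed point is again the fixed point of a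
   contraction, [v |-> dK ((p, s p), (w, v))], whose parameters range over
   [(P * X) * P]; this is why the induction on [n] quantifies over [P]. *)
Lemma Ck_fixed_point (X : completeNormedModType R) n :
  forall (P : tvsType R) (A : set P) (B : set X) (K : P * X -> X) (s : P -> X),
  hausdorff_space P -> open A -> open B -> smooth_on (A `*` B) K ->
  (forall p x y, A p -> B x -> B y ->
    `|K (p, x) - K (p, y)| <= 2^-1 * `|x - y|) ->
  (forall p, A p -> B (s p) /\ K (p, s p) = s p) ->
  Ck_on n A s.
Proof.
have hX : hausdorff_space X by exact: norm_hausdorff.
elim: n => [|n IH] P A B K s hP oA oB sK Kl sP.
  by split=> //; exact: (fixed_point_continuous oA (sK 0).1 Kl sP).
have [cK [dK _]] := sK 1.
have oAB : open (A `*` B) by exact: openX.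
have lK q : (A `*` B) q -> linear (gderive K q).
  by move=> qAB; exact: (gderive_linear hX oAB (sK 1)).
(* Differentiation in the second variable keeps the contraction constant, because the difference
   quotients satisfy the bound and closed balls are closed. *)
have dKl p x w v v' : A p -> B x ->
    `|gderive K (p, x) (w, v) - gderive K (p, x) (w, v')| <= 2^-1 * `|v - v'|.
  move=> Ap Bx.
  have -> : gderive K (p, x) (w, v) - gderive K (p, x) (w, v') =
      gderive K (p, x) (0, v - v').
    have -> : (0, v - v') = (-1) *: (w, v') + (w, v) :> P * X.
      by apply: injective_projections; rewrite /= ?scaleN1r ?addNr// addrC.
    by rewrite lK // scaleN1r addrC.
  set u := v - v'.
  have := gderivableP (dK (p, x) (0, u) (conj Ap Bx)).
  apply: (closed_cvg _ (@closed_norm_le X (2^-1 * `|u|))).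
  have Bxu : \forall t \near (0 : R), B (x + t *: u).
    by apply: near_line; exact: open_nbhs_nbhs.
  near=> t; rewrite /=.
  have t0 : t != 0 by near: t; exact: nbhs_dnbhs_neq.
  have := @Kl p (x + t *: u) x Ap _ Bx.
  have -> : x + t *: u - x = t *: u by rewrite addrAC subrr add0r.
  rewrite /diff_quotient !normrZ normfV ler_pdivrMl ?normr_gt0// mulrCA.
  have -> : (p, x) + t *: (0, u) = (p, x + t *: u).
    by apply: injective_projections; rewrite /= ?scaler0 ?addr0.
  by apply; near: t; exact: nbhs_dnbhs.
have /choice[s2 s2P] (q : (P * X) * P) : exists v,
    (A `*` B) q.1 -> gderive K q.1 (q.2, v) = v.
  case: q => [[p x] w] /=; have [[Ap Bx]|nAB] := pselect ((A `*` B) (p, x)); last first.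
    by exists 0 => /nAB.
  have [||//||v _ vE] := @contraction_fixed_point X setT
    (fun v => gderive K (p, x) (w, v)); last by exists v.
  - exact: closedT.
  - by exists 0.
  - by move=> v v' _ _; exact: dKl.
(* The point s(p) + t v is an approximate fixed point for the parameter p + t w: as v = dK(w, v),
   its displacement is o(t). Hence s(p + t w) differs from it by o(t) only. *)
have ds p w : A p -> diff_quotient s p w @ 0^' --> s2 ((p, s p), w).
  move=> Ap; have [Bs Ks] := sP p Ap.
  set v := s2 _; have vE : gderive K (p, s p) (w, v) = v.
    exact: (s2P ((p, s p), w) (conj Ap Bs)).
  have := gderivableP (dK (p, s p) (w, v) (conj Ap Bs)).
  rewrite vE => dKv; apply: cvg_dist_dominated dKv.
  have Ap' : \forall t \near (0 : R), A (p + t *: w).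
    by apply: near_line; exact: open_nbhs_nbhs.
  have Bs' : \forall t \near (0 : R), B (s p + t *: v).
    by apply: near_line; exact: open_nbhs_nbhs.
  near=> t.
  have t0 : t != 0 by near: t; exact: nbhs_dnbhs_neq.
  have Apt : A (p + t *: w) by near: t; exact: nbhs_dnbhs.
  have Bst : B (s p + t *: v) by near: t; exact: nbhs_dnbhs.
  have [Bs1 Ks1] := sP _ Apt.
  have := Kl _ _ _ Apt Bs1 Bst; rewrite Ks1.
  rewrite /diff_quotient Ks.
  have -> : (p, s p) + t *: (w, v) = (p + t *: w, s p + t *: v) by [].
  set st := s (p + _); set kt := K _.
  have E z : t^-1 *: (z - s p) - v = t^-1 *: (z - (s p + t *: v)).
    by rewrite opprD addrA scalerBr [in RHS]scalerBr scalerA mulVf// scale1r -scalerBr.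
  rewrite !E !normrZ mulrCA ler_pM2l ?normr_gt0 ?invr_eq0//.
  have := ler_normD (st - kt) (kt - (s p + t *: v)).
  by rewrite addrA subrK; lra.
split; first exact: (fixed_point_continuous oA cK Kl sP).
split=> [p w Ap|]; first by eexists; exact: ds.
apply: (@Ck_eq _ _ _ _ _ (s2 \o (fun p => ((p.1, s p.1), p.2)))).
- exact: openXT.
- move=> [p w] /set_mem [/= Ap _]; apply/esym/diff_quotient_unique => //.
  exact: ds.
have hPX : hausdorff_space (P * X)%type by exact: hausdorff_prod.
have oAT : open (A `*` [set: P]) by exact: openXT.
apply: (@Ck_comp _ _ _ _ _ _ ((A `*` B) `*` [set: P])) => //.
- exact: hausdorff_prod.
- exact: hausdorff_prod.
- exact: openXT.
- by move=> [p w] [/= Ap _]; split => //; split => //; case: (sP p Ap).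
- apply: Ck_pair => //; last first.
    by apply: Ck_linear => // p; exact: cvg_snd.
  apply: Ck_pair => //.
    by apply: Ck_linear => // p; exact: cvg_fst.
  apply: (@Ck_comp _ _ _ _ _ _ A fst) => //.
  + exact: hausdorff_prod.
  + by move=> p [].
  + by apply: Ck_linear => // p; exact: cvg_fst.
  + exact: (IH _ _ B K).
(* For [s2] the unknown ranges over all of [X], since the linearised contraction is defined and
   contracting for every v. *)
apply: (IH _ _ setT (fun z => gderive K z.1.1 (z.1.2, z.2))).
- exact: hausdorff_prod.
- exact: openXT.
- exact: openT.
- move=> k.
  apply: (@Ck_comp _ _ _ _ _ _ _ (fun z : ((P * X) * P) * X => (z.1.1, (z.1.2, z.2)))
    (fun z : (P * X) * (P * X) => gderive K z.1 z.2)); last first.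
  + exact: (sK k.+1).2.2.
  + apply: Ck_linear.
    * by apply: hausdorff_prod.
    * by move=> a z z'.
    * apply: pair_continuous; last (apply: pair_continuous; last exact: proj2_continuous).
        by apply: comp_continuous; exact: proj1_continuous.
      by apply: comp_continuous; [exact: proj1_continuous|exact: proj2_continuous].
  + by move=> [[[p x] w] v] [[[? ?] ?] ?].
  + exact: openXT.
  + by do 2! apply: openXT.
  + by [].
  + exact: hausdorff_prod.
  + by apply: hausdorff_prod => //; exact: hausdorff_prod.
- by move=> [[p x] w] v v' [[Ap Bx] _] _ _; exact: dKl.
- by move=> q [qAB _]; split => //; exact: s2P.
Unshelve. all: by end_near. Qed.

End FixedPoint.

(** * The inverse function theorem near a point with derivative 1 *)

Section InverseFunction.
Context {R : realType}.

Lemma open_preimage_in (S T : topologicalType) (f : S -> T) (A : set S)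
    (B : set T) : open A -> {in A, continuous f} -> open B ->
  open [set x | A x /\ B (f x)].
Proof.
move=> oA cf oB; rewrite openE => x [Ax Bfx].
rewrite /interior /=; apply: (@filterI _ (nbhs x) _ A (f @^-1` B)).
  exact: open_nbhs_nbhs.
by apply: (cf x (mem_set Ax)); exact: open_nbhs_nbhs.
Qed.

Lemma open_norm_lt (X : normedModType R) (r : R) : open [set x : X | `|x| < r].
Proof.
have -> : [set x : X | `|x| < r] = (fun x => `|x|) @^-1` [set z | z < r] by [].
apply: open_comp; last exact: open_lt.
by move=> x _; exact: norm_continuous.
Qed.

Lemma convex_norm_lt (X : normedModType R) (r : R) :
  convex_subset [set x : X | `|x| < r].
Proof.
move=> a b l /= ar br /andP[l0 l1].
apply: (le_lt_trans (ler_normD _ _)); rewrite !normrZ !ger0_norm ?subr_ge0//.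
have [->|l0'] := eqVneq l 0; first by rewrite mul0r add0r subr0 mul1r.
have lp : 0 < l by rewrite lt_neqAle eq_sym l0'.
rewrite (_ : r = l * r + (1 - l) * r); last by ring.
by apply: ltr_leD; [rewrite ltr_pM2l|rewrite ler_wpM2l ?subr_ge0// ltW].
Qed.

(* Boundedness of the second derivative near 0 makes the first derivative small
   in operator norm, which its mere joint continuity would not. *)
Lemma C2_contraction (X : normedModType R) (U : set X) (h : X -> X) :
  open U -> U 0 -> Ck_on 2 U h -> (forall v, gderive h 0 v = 0) ->
  exists r, [/\ 0 < r, [set x | `|x| < r] `<=` U &
    forall x y, `|x| < r -> `|y| < r -> `|h x - h y| <= 2^-1 * `|x - y|].
Proof.
move=> oU U0 C2 dh0.
have hX : hausdorff_space X by exact: norm_hausdorff.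
have [ch [dh [cdh [ddh [cddh _]]]]] := C2.
pose dh' (p : X * X) := gderive h p.1 p.2.
(* At the origin the direction is 0 and so is the derivative; joint continuity bounds it by 1 on a
   product of neighbourhoods, and homogeneity will turn this into a bound proportional to the
   direction. *)
have : \forall P \near ((0 : X, 0 : X), (0 : X, 0 : X)),
    `|gderive dh' P.1 P.2| < 1.
  have /= := cddh ((0, 0), (0, 0)); rewrite inE => /(_ (conj (conj U0 I) I)).
  move=> /cvgr_norm_lt; apply.
  by rewrite (@gderive0 R (X * X)%type X)// normr0.
case=> [[S1 S2] [/= [[A B] [/= nA nB] AB] [[C D] [/= nC nD] CD]]] S12.
have : nbhs (0 : X) ((A `&` B) `&` (C `&` U)).
  by apply: filterI; apply: filterI => //; exact: open_nbhs_nbhs.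
move=> /nbhs_normP [d /= d0 dS].
have {}dS x : `|x| < d -> [/\ A x, B x, C x & U x].
  by move=> xd; have [|[? ?] [? ?]] := dS x; first by rewrite /= sub0r normrN.
have bound x v a : `|x| < d -> `|v| < d -> `|a| < d ->
    `|gderive dh' (x, v) (a, 0)| < 1.
  move=> /dS [Ax _ _ _] /dS [_ Bv _ _] /dS[_ _ Ca _].
  apply: (S12 ((x, v), (a, 0))); split => /=; first exact: AB.
  by apply: CD; split => //; exact: nbhs_singleton nD.
(* Mean value theorem from (0, v) to (x, v): writing x = e (x / e) with |x / e| < d extracts the
   factor e from the bound 1. *)
have small e x v : 0 < e -> `|x| < d -> `|x| < e * d -> `|v| < d ->
    `|gderive h x v| < e.
  move=> e0 xd xed vd.
  have -> : gderive h x v = dh' ((0, v) + (x, 0)) - dh' (0, v).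
    by rewrite /dh' /= dh0 subr0 add0r addr0.
  have Us s : 0 <= s <= 1 -> `|s *: x| < d.
    move=> /andP[s0 s1]; rewrite normrZ ger0_norm//.
    by apply: le_lt_trans xd; rewrite ler_piMl.
  have E s : (0, v) + s *: (x, 0) = (s *: x, v) :> X * X.
    by apply: injective_projections; rewrite /= ?scaler0 ?addr0 ?add0r.
  apply: (@segment_mean_value R _ _ dh' (0, v) (x, 0) [set z | `|z| < e]).
  - exact: convex_norm_lt.
  - by move=> s s01; rewrite E; apply: ddh; split => //; have [] := dS _ (Us s s01).
  - move=> s s01; rewrite E; apply: open_nbhs_nbhs; split; first exact: open_norm_lt.
    have -> : (x, 0) = e *: (e^-1 *: x, 0) :> X * X.
      apply: injective_projections; rewrite /= ?scaler0//.
      by rewrite scalerA mulfV ?scale1r// gt_eqF.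
    have Usx : (U `*` [set: X]) (s *: x, v) by split => //; have [] := dS _ (Us s s01).
    have -> := diff_quotient_unique hX (@gderiveZ _ _ _ _ _ _ e hX (ddh _ (e^-1 *: x, 0) Usx)).
    rewrite /= normrZ gtr0_norm// -[ltRHS]mulr1 ltr_pM2l//; apply: bound => //.
      exact: Us.
    by rewrite normrZ gtr0_norm ?invr_gt0// ltr_pdivrMl.
(* A direction v is rescaled by c to length d / 2. The desired bound |v| / 2 then becomes c |v| / 2
   = d / 4, which [small] gives when |x| < (d / 4) d. *)
pose r := Num.min d (d / 4 * d).
have r0 : 0 < r by rewrite /r lt_min d0/= mulr_gt0// divr_gt0.
have small2 x v : `|x| < r -> v != 0 -> `|gderive h x v| < 2^-1 * `|v|.
  rewrite /r lt_min => /andP[xd xdd] v0.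
  have v0' : 0 < `|v| by rewrite normr_gt0.
  have [_ _ _ Ux] := dS x xd.
  pose c := (d / 2) / `|v|; have c0 : 0 < c by rewrite !divr_gt0.
  have cv : `|c *: v| = d / 2 by rewrite normrZ gtr0_norm// /c divfK// gt_eqF.
  have d4 : 0 < d / 4 by rewrite divr_gt0.
  have := @small (d / 4) x (c *: v) d4 xd xdd; rewrite cv.
  have -> := diff_quotient_unique hX (@gderiveZ _ _ _ _ _ _ c hX (dh x v Ux)).
  have -> : d / 4 = c * (2^-1 * `|v|) by rewrite /c; field; rewrite gt_eqF.
  by rewrite normrZ (gtr0_norm c0) ltr_pM2l//; apply; lra.
exists r; split=> // [x xr|x y xr yr].
  by have [] := dS x; first by move: xr; rewrite /= lt_min => /andP[].
have [->|xy] := eqVneq x y; first by rewrite !subrr normr0 mulr0.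
have Bs s : 0 <= s <= 1 -> `|y + s *: (x - y)| < r.
  move=> s01; have := @convex_norm_lt X r x y s xr yr s01.
  by rewrite /= scalerBl scale1r scalerBr [s *: x + _]addrC addrA addrAC.
rewrite -[x in h x](subrKC y) ltW//.
apply: (@segment_mean_value R _ _ h y (x - y) [set z | `|z| < 2^-1 * `|x - y|]).
- exact: convex_norm_lt.
- move=> s s01; apply: dh.
  by have [] := dS (y + s *: (x - y)); first by have := Bs s s01; rewrite lt_min => /andP[].
- move=> s s01; apply: open_nbhs_nbhs; split; first exact: open_norm_lt.
  by apply: small2; [exact: Bs|rewrite subr_eq0].
Qed.

(** The preimage of y under x - h(x) is the fixed point of x |-> y + h(x), with y as the parameter
    in the smooth dependence of fixed points. *)
Lemma inverse_function (X : completeNormedModType R) (U : set X) (h : X -> X) :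
  open U -> U 0 -> smooth_on U h -> h 0 = 0 -> (forall v, gderive h 0 v = 0) ->
  exists c : chart X X, [/\ chart_dom c 0, chart_dom c `<=` U,
    chart_map c = (fun x => x - h x) & smooth_on (chart_cod c) (chart_inv c)].
Proof.
move=> oU U0 sh h0 dh0.
have hX : hausdorff_space X by exact: norm_hausdorff.
have [r [r0 rU hl]] := C2_contraction oU U0 (sh 2) dh0.
(* For |y| < r / 2 the closed ball of radius 2 |y| lies in [B], and x |-> y + h(x) maps it to itself
   because |h(x)| <= |x| / 2 <= |y|. *)
pose B := [set x : X | `|x| < r]; pose A := [set x : X | `|x| < r / 2].
have ex_s (y : X) : exists x, A y -> B x /\ y + h x = x.
  have [Ay|nAy] := pselect (A y); last by exists 0 => /nAy.
  have yB x : `|x| <= 2 * `|y| -> B x.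
    by move=> xy; apply: (le_lt_trans xy); move: Ay; rewrite /A/=; lra.
  have [||||x xy xE] := @contraction_fixed_point R X [set x | `|x| <= 2 * `|y|]
      (fun x => y + h x).
  - exact: closed_norm_le.
  - by exists 0; rewrite /= normr0 mulr_ge0.
  - move=> x /= xy; apply: (le_trans (ler_normD _ _)).
    have := hl x 0 (yB _ xy); rewrite normr0 h0 !subr0 => /(_ r0); lra.
  - move=> x x' xy x'y; rewrite opprD addrACA subrr add0r.
    by apply: hl; exact: yB.
  by exists x => _; split=> //; exact: yB.
have [s sP] := choice ex_s.
have oA : open A by exact: open_norm_lt.
have oB : open B by exact: open_norm_lt.
have sB : smooth_on B h by move=> n; exact: Ck_sub (sh n).
have Kl (p x y : X) : A p -> B x -> B y ->
    `|(p + h x) - (p + h y)| <= 2^-1 * `|x - y|.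
  by move=> _ Bx By; rewrite opprD addrACA subrr add0r; exact: hl.
have uniq y x : A y -> B x -> y + h x = x -> s y = x.
  move=> Ay Bx xE; have [Bs sE] := sP y Ay.
  apply/eqP; rewrite -subr_eq0 -normr_eq0; apply/eqP.
  by have := Kl y _ _ Ay Bs Bx; rewrite sE xE; have := normr_ge0 (s y - x); lra.
have ss : smooth_on A s.
  move=> n; apply: (@Ck_fixed_point R X n X A B (fun p => p.1 + h p.2)) => //.
  move=> k; apply: Ck_D => //; first by apply: openX.
    by apply: Ck_linear => //; exact: proj1_continuous.
  apply: (@Ck_comp _ _ _ _ _ _ B snd) => //; first by apply: openX.
  - by move=> p [].
  - by apply: Ck_linear => //; exact: proj2_continuous.
have cm : {in B, continuous (fun x => x - h x)}.
  by move=> x Bx; apply: tvs_cvgB; [exact: cvg_id|exact: (Ck_continuous (sB 0))].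
pose D := [set x | B x /\ A (x - h x)].
have oD : open D by exact: open_preimage_in.
have mP x : D x -> A (x - h x) by case.
have iP x : A x -> D (s x).
  by move=> Ax; have [Bs sE] := sP x Ax; split=> //; rewrite -{1}sE addrK.
have mK x : D x -> s (x - h x) = x.
  by move=> [Bx Ax]; apply: uniq => //; rewrite subrK.
have iK x : A x -> s x - h (s x) = x.
  by move=> Ax; have [Bs sE] := sP x Ax; rewrite -{1}sE addrK.
have cmD : {in D, continuous (fun x => x - h x)}.
  by move=> x /set_mem[Bx _]; apply: cm; exact/mem_set.
exists (@Chart R X X D A (fun x => x - h x) s oD oA mP iP mK iK cmD
  (Ck_continuous (ss 0))); split => //=.
  by split; rewrite /B/A/= ?h0 ?subr0 normr0// divr_gt0.
by move=> x [/rU].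
Qed.

End InverseFunction.

(** * Regular operators and pseudo-inverses *)

Section Regularity.
Context {R : realType}.
Implicit Types X Y Z : tvsType R.

Lemma lin0 (X Y : lmodType R) (f : X -> Y) : linear f -> f 0 = 0.
Proof. by move=> lf; have := lf (-1) 0 0; rewrite scaler0 addr0 scaleN1r addNr. Qed.

Lemma linD (X Y : lmodType R) (f : X -> Y) x y : linear f -> f (x + y) = f x + f y.
Proof. by move=> lf; have := lf 1 x y; rewrite !scale1r. Qed.

Lemma linZ (X Y : lmodType R) (f : X -> Y) a x : linear f -> f (a *: x) = a *: f x.
Proof. by move=> lf; have := lf a x 0; rewrite !addr0 lin0// addr0. Qed.

Lemma linB (X Y : lmodType R) (f : X -> Y) x y : linear f -> f (x - y) = f x - f y.
Proof. by move=> lf; rewrite linD// -scaleN1r linZ// scaleN1r. Qed.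

Lemma linear_comp (X Y Z : lmodType R) (f : X -> Y) (g : Y -> Z) :
  linear f -> linear g -> linear (g \o f).
Proof. by move=> lf lg a x y; rewrite /= lf lg. Qed.

Lemma diff_quotient_comp_linear X Y Z (f : X -> Y) (g : Y -> Z) x v : linear g ->
  diff_quotient (fun y => g (f y)) x v = fun t => g (diff_quotient f x v t).
Proof.
by move=> lg; apply/funext => t; rewrite /diff_quotient (linZ _ _ lg) (linB _ _ lg).
Qed.

Lemma topological_sumC X (A B : set X) :
  topological_sum A B -> topological_sum B A.
Proof.
move=> [lA lB AB [p [q [cp cq pq]]]]; split=> //; first by rewrite setIC.
by exists q, p; split=> // x; have [? ? e] := pq x; split => //; rewrite addrC.
Qed.

Lemma linear_subspaceB X (A : set X) a b : linear_subspace A ->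
  A a -> A b -> A (a - b).
Proof. by move=> [_ lA] Aa Ab; rewrite addrC -scaleN1r; exact: lA. Qed.

Lemma topological_sum_uniq X (A B : set X) a b a' b' : topological_sum A B ->
  A a -> B b -> A a' -> B b' -> a + b = a' + b' -> a = a' /\ b = b'.
Proof.
move=> [lA lB AB _] Aa Bb Aa' Bb' e.
have e' : a - a' = b' - b.
  by apply/eqP; rewrite subr_eq addrAC -subr_eq opprK e addrC.
have : [set 0] (a - a').
  by rewrite -AB; split; [|rewrite e']; exact: linear_subspaceB.
move=> /= e0; move: e'; rewrite e0 => /esym/eqP; rewrite subr_eq0 => /eqP ->.
by split=> //; apply/eqP; rewrite -subr_eq0 e0.
Qed.

Lemma topological_sum_proj X (A B : set X) : topological_sum A B ->
  exists q : X -> X, [/\ linear q, continuous q, (forall x, A (x - q x)),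
    (forall x, B (q x)) & forall a b, A a -> B b -> q (a + b) = b].
Proof.
move=> AB; have [lA lB _ [p [q [cp cq pq]]]] := AB.
have qE a b : A a -> B b -> q (a + b) = b.
  move=> Aa Bb; have [Ap Bq e] := pq (a + b).
  by have [] := topological_sum_uniq AB Ap Bq Aa Bb (esym e).
exists q; split => // [r x y|x|x]; last 2 first.
- by have [Ap _ e] := pq x; rewrite {1}e addrK.
- by have [] := pq x.
have [Ax Bx ex] := pq x; have [Ay By ey] := pq y.
rewrite {1}ex {1}ey scalerDr addrACA; apply: qE.
- by case: lA => _; exact.
- by case: lB => _; exact.
Qed.

Lemma continuous_linear_projection_sum X (p : X -> X) : linear p -> continuous p ->
  (forall x, p (p x) = p x) ->
  topological_sum [set x | p x = 0] [set x | p x = x].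
Proof.
move=> lp cp pp; split.
- split; first exact: lin0.
  by move=> a x y /= px py; rewrite lp px py scaler0 addr0.
- split; first exact: lin0.
  by move=> a x y /= px py; rewrite lp px py.
- by apply/seteqP; split=> x /= => [[->]//|->]; split; exact: lin0.
- exists (fun x => x - p x), p; split => //.
    by move=> x; apply: tvs_cvgB; [exact: cvg_id|exact: cp].
  move=> x; split; last by rewrite subrK.
  - by rewrite /= linB// pp subrr.
  - exact: pp.
Qed.

Definition pseudo_inverse X Y (T : X -> Y) (S : Y -> X) : Prop :=
  [/\ linear S, continuous S, forall x, T (S (T x)) = T x &
      forall y, S (T (S y)) = S y].

(** The kernel of [T] is that of the idempotent S T, and its range is the fixed-point set of the
    idempotent T S; kernels and fixed-point sets of continuous idempotents are closed and
    complemented. *)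
Lemma pseudo_inverse_regular X Y (T : X -> Y) (S : Y -> X) :
  hausdorff_space X -> hausdorff_space Y -> linear T -> continuous T ->
  pseudo_inverse T S -> regular_operator T.
Proof.
move=> hX hY lT cT [lS cS TST STS].
have c1 : closed [set (0 : Y)].
  by apply: accessible_closed_set1; exact: hausdorff_accessible.
have cST : continuous (fun x => S (T x)) by exact: comp_continuous.
have cTS : continuous (fun x => T (S x)) by exact: comp_continuous.
have kerE : T @^-1` [set 0] = [set x | S (T x) = 0].
  apply/seteqP; split=> x /=; first by move=> ->; exact: lin0.
  by move=> ST0; rewrite -TST ST0 lin0.
have rangeE : range T = [set y | T (S y) = y].
  apply/seteqP; split=> y /=; first by move=> [x _ <-].
  by move=> <-; exists (S y).
split => //.
(* The preimages of a point y of the range are the points S y + k with k in the kernel, and for each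
   k the condition that S y + k lies in [U] is open in y. *)
- move=> U oU; exists (\bigcup_(k in T @^-1` [set 0]) [set y | U (S y + k)]).
    apply: bigcup_open => k _.
    have : continuous (fun y => S y + k).
      by move=> y; apply: tvs_cvgD; [exact: cS|exact: cvg_cst].
    by move=> /continuousP; apply.
  apply/seteqP; split=> y.
    move=> [x Ux <-]; split; last by exists x.
    by exists (x - S (T x)); [rewrite /= linB// TST subrr|rewrite /= subrKC].
  move=> [[k /= Tk0 Uk] [x _ Tx]]; exists (S y + k) => //.
  by rewrite linD// Tk0 addr0 -Tx TST.
- split; first by apply: preimage_closed => // x _; exact: cT.
  exists [set x | S (T x) = x]; rewrite kerE.
  apply: (@continuous_linear_projection_sum X (fun x => S (T x))) => //.
  exact: (linear_comp lT lS).
rewrite rangeE; split.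
  have -> : [set y | T (S y) = y] = (fun y => T (S y) - y) @^-1` [set 0].
    by apply/seteqP; split=> y /= e; [rewrite e subrr|apply/eqP; rewrite -subr_eq0 e].
  apply: preimage_closed => // y _; apply: tvs_cvgB; [exact: cTS|exact: cvg_id].
exists [set y | T (S y) = 0]; apply: topological_sumC.
apply: (@continuous_linear_projection_sum Y (fun x => T (S x))) => //.
exact: (linear_comp lS lT).
Qed.

(** [S] projects onto the range along a complement and then inverts [T] on a complement [C] of the
    kernel. *)
Lemma regular_pseudo_inverse X Y (T : X -> Y) :
  regular_operator T -> exists S, pseudo_inverse T S.
Proof.
move=> [lT cT oT [_ [C KC]] [_ [W /topological_sumC WR]]].
have [p [lp cp Kp Cp pE]] := topological_sum_proj KC.
have [q [lq cq _ Rq qE]] := topological_sum_proj WR.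
have [_ _ KC0 _] := KC; have [lW _ _ _] := WR.
have qT x : q (T x) = T x.
  by rewrite -[T x in LHS]add0r; apply: qE; [case: lW|exists x].
have Tp x : T (p x) = T x.
  by have /eqP := Kp x; rewrite linB// subr_eq0 => /eqP.
(* An arbitrary preimage: its projection to [C] does not depend on the choice, as [T] is injective
   on [C]. *)
have /choice[g gE] (y : Y) : exists x, T x = q y.
  by have [x _ xE] := Rq y; exists x.
pose S y := p (g y).
have CS y : C (S y) by exact: Cp.
have TS y : T (S y) = q y by rewrite /S Tp gE.
have [_ lC _ _] := KC.
have Tinj c c' : C c -> C c' -> T c = T c' -> c = c'.
  move=> Cc Cc' e; apply/eqP; rewrite -subr_eq0; apply/eqP.
  have : [set 0] (c - c'); last by [].
  by rewrite -KC0; split; [rewrite /= linB// e subrr|exact: linear_subspaceB].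
exists S; split.
- move=> a y y'; apply: Tinj => //; first by case: lC => _; apply.
  by rewrite TS lT !TS lq.
(* Relative openness, applied to the preimage of [O] under [p], yields [V] whose preimage under [q]
   is the preimage of [O] under [S]. *)
- apply/continuousP => O oO.
  have [|V oV VE] := oT (p @^-1` O); first by move/continuousP: cp; apply.
  suff -> : S @^-1` O = q @^-1` V by move/continuousP: cq; apply.
  apply/seteqP; split=> y /=.
    move=> OS; suff : (V `&` range T) (q y) by case.
    rewrite -VE; exists (S y); last exact: TS.
    rewrite /=; suff -> : p (S y) = S y by [].
    by apply: Tinj => //; rewrite Tp.
  move=> Vq; have : (V `&` range T) (q y) by split => //; exact: Rq.
  rewrite -VE => -[x /= Op Tx]; suff -> : S y = p x by [].
  by apply: Tinj => //; rewrite TS Tp.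
- by move=> x; rewrite TS qT.
- by move=> y; apply: Tinj => //; rewrite TS qT.
Qed.

Lemma continuous_within_comp (S T U : topologicalType) (A : set T)
    (f : S -> T) (g : T -> U) : continuous f -> (forall x, A (f x)) ->
  {within A, continuous g} -> continuous (fun x => g (f x)).
Proof.
move=> cf Af /subspace_continuousP cg x O gO.
have h : nbhs x (f @^-1` (fun t => A t -> O (g t))).
  by apply: cf; exact: (cg (f x) (Af x) O gO).
by apply: filterS h => y; apply; exact: Af.
Qed.

End Regularity.

(** * The Hahn--Banach theorem *)

Section HahnBanach.
Context {R : realType}.

Section Sublinear.
Variable E : lmodType R.
Implicit Types p q : E -> R.

(** Homogeneity is asked only as an inequality for positive factors, a form that is easy to verify
    for infima; the equality follows by using the inverse factor. *)
Definition sublinear p : Prop :=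
  [/\ p 0 = 0, forall x y, p (x + y) <= p x + p y &
      forall r x, 0 < r -> p (r *: x) <= r * p x].

Lemma sublinear_opp p x : sublinear p -> - p (- x) <= p x.
Proof. by move=> [p0 pD _]; have := pD x (- x); rewrite subrr p0; lra. Qed.

Lemma sublinearZ p r x : sublinear p -> 0 <= r -> p (r *: x) = r * p x.
Proof.
move=> [p0 _ pZ]; rewrite le_eqVlt => /predU1P[<-|r0].
  by rewrite scale0r mul0r.
apply/eqP; rewrite eq_le pZ//=.
have := pZ r^-1 (r *: x); rewrite invr_gt0 scalerA mulVf ?gt_eqF// scale1r.
by move=> /(_ r0); rewrite ler_pdivlMl.
Qed.

(* As [q (- e) <= - p e], a linear functional below [q] agrees with [p] at [e].
   Applied to a minimal [p], the lemma also yields the additivity of [p]. *)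
Lemma sublinear_below p (e : E) : sublinear p ->
  exists q, [/\ sublinear q, forall x, q x <= p x &
    forall x, q x <= p (x + e) - p e].
Proof.
move=> sp; have [p0 pD pZ] := sp.
(* [q] is the infimum of these values: t = 0 gives q <= p and t = 1 gives the last bound. For
   subadditivity, t at x and s at y are combined into t + s at x + y. *)
pose A x := [set p (x + t *: e) - t * p e | t in [set t : R | 0 <= t]].
have A0 x : A x !=set0 by exists (p (x + 0 *: e) - 0 * p e), 0 => //=.
have lbA x : has_lbound (A x).
  exists (- p (- x)) => _ [t /= t0 <-]; rewrite -sublinearZ//.
  by have := pD (x + t *: e) (- x); rewrite addrC addKr; lra.
pose q x := inf (A x).
have qA x t : 0 <= t -> q x <= p (x + t *: e) - t * p e.
  by move=> t0; apply: ge_inf => //; exists t.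
have Aq x c : (forall t, 0 <= t -> c <= p (x + t *: e) - t * p e) -> c <= q x.
  by move=> h; apply: lb_le_inf => // _ [t t0 <-]; exact: h.
exists q; split.
- split.
  + apply/eqP; rewrite eq_le; apply/andP; split.
      by apply: (le_trans (qA 0 0 (lexx _))); rewrite scale0r addr0 p0 mul0r subr0.
    by apply: (Aq) => t t0; rewrite add0r sublinearZ// subrr.
  + move=> x y; rewrite -lerBlDl; apply: (Aq) => s s0.
    rewrite lerBlDl -lerBlDr; apply: (Aq) => t t0; rewrite lerBlDr.
    have := qA (x + y) (t + s) (addr_ge0 t0 s0).
    have := pD (x + t *: e) (y + s *: e).
    by rewrite addrACA -scalerDl mulrDl; lra.
  + move=> r x r0; rewrite -ler_pdivrMl//; apply: (Aq) => t t0.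
    rewrite ler_pdivrMl//; have := qA (r *: x) (r * t) (mulr_ge0 (ltW r0) t0).
    by rewrite -scalerA -scalerDr (sublinearZ _ sp (ltW r0)) mulrBr mulrA.
- by move=> x; have := qA x 0 (lexx _); rewrite scale0r addr0 mul0r subr0.
- by move=> x; have := qA x 1 ler01; rewrite scale1r mul1r.
Qed.

(** Zorn's lemma for the reversed pointwise order. The infimum of a nonempty chain is finite, being
    at least - p(- x), and subadditive because of any two members the smaller one serves for both
    summands. *)
Lemma minimal_sublinear p : sublinear p ->
  exists q, [/\ sublinear q, forall x, q x <= p x &
    forall q', sublinear q' -> (forall x, q' x <= q x) -> q' = q].
Proof.
move=> sp.
pose T := {q : E -> R | sublinear q /\ forall x, q x <= p x}.
pose r (q q' : T) := `[< forall x, sval q' x <= sval q x >].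
have [| | |A Atot|[q [sq qp]] qmax] := @Zorn T r.
- by move=> q; apply/asboolP.
- move=> q1 q2 q3 /asboolP h12 /asboolP h23; apply/asboolP => x.
  exact: le_trans (h23 x) (h12 x).
- move=> [q1 h1] [q2 h2] /asboolP/= h12 /asboolP/= h21.
  have e : q1 = q2 by apply/funext => x; apply/eqP; rewrite eq_le h12 h21.
  by apply: eq_exist.
- have [A0|/set0P/negP] := pselect (A !=set0); last first.
    rewrite negbK => /eqP ->.
    by exists (exist _ p (conj sp (fun x => lexx _))) => ? [].
  pose B x := [set sval q x | q in A].
  have B0 x : B x !=set0 by case: A0 => q Aq; exists (sval q x), q.
  have lbB x : has_lbound (B x).
    exists (- p (- x)) => _ [[q [sq qp]] Aq <-] /=.
    by have := sublinear_opp x sq; have := qp (- x); lra.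
  pose m x := inf (B x).
  have mB (q : T) x : A q -> m x <= sval q x.
    by move=> Aq; apply: ge_inf => //; exists q.
  have Bm x c : (forall k : T, A k -> c <= sval k x) -> c <= m x.
    by move=> h; apply: lb_le_inf => // _ [q Aq <-]; exact: h.
  have sT (k : T) : sublinear (sval k) by case: (svalP k).
  have mp x : m x <= p x.
    case: A0 => q Aq; apply: (le_trans (mB q x Aq)).
    by case: (svalP q) => _; exact.
  suff sm : sublinear m.
    by exists (exist _ m (conj sm mp)) => q Aq; apply/asboolP => x; exact: mB.
  split.
  + apply/eqP; rewrite eq_le; apply/andP; split.
      case: A0 => q Aq; apply: (le_trans (mB q 0 Aq)).
      by have [q0 _ _] := sT q; rewrite q0.
    by apply: (Bm) => q Aq; have [q0 _ _] := sT q; rewrite q0.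
  + move=> x y; rewrite -lerBlDl; apply: (Bm) => q Aq.
    rewrite lerBlDl -lerBlDr; apply: (Bm) => q' Aq'; rewrite lerBlDr.
    have h1 (k : T) : sval k (x + y) <= sval k x + sval k y.
      by have [_ kD _] := sT k; exact: kD.
    have [/asboolP h|/asboolP h] := Atot _ _ Aq Aq'.
      apply: (le_trans (mB q' _ Aq')); apply: (le_trans (h1 q')).
      by rewrite lerD2l; exact: h.
    apply: (le_trans (mB q _ Aq)); apply: (le_trans (h1 q)).
    by rewrite lerD2r; exact: h.
  + move=> t x t0; rewrite -ler_pdivrMl//; apply: (Bm) => q Aq.
    rewrite ler_pdivrMl//; apply: (le_trans (mB q _ Aq)).
    by have [_ _ qZ] := sT q; exact: qZ.
exists q; split => // q' sq' q'q.
have q'p x : q' x <= p x by exact: le_trans (q'q x) (qp x).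
have e := qmax (exist _ q' (conj sq' q'p)) (asboolT q'q).
exact: (congr1 (@sval _ _) e).
Qed.

(** A minimal sublinear function is linear, so no partially defined functional is ever extended; the
    value at [e] is secured beforehand by passing from [p] to [pe]. *)
Lemma hahn_banach p (e : E) : sublinear p ->
  exists phi : E -> R, [/\ forall a x y, phi (a *: x + y) = a * phi x + phi y,
    forall x, phi x <= p x & phi e = p e].
Proof.
move=> sp; have [pe [spe pep pee]] := sublinear_below e sp.
have [q [sq qpe qmin]] := minimal_sublinear spe.
have qD x y : q (x + y) = q x + q y.
  have [_ qD _] := sq.
  apply/eqP; rewrite eq_le qD/=.
  have [q' [sq' q'q q'y]] := sublinear_below y sq.
  by have := q'y x; rewrite (qmin _ sq' q'q); lra.
have q0 : q 0 = 0 by case: sq.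
have qN x : q (- x) = - q x.
  by have := qD x (- x); rewrite subrr q0; lra.
have qZ a x : q (a *: x) = a * q x.
  have [a0|a0] := leP 0 a; first exact: sublinearZ.
  rewrite -[a in LHS]opprK scaleNr qN sublinearZ//; first by rewrite mulNr opprK.
  by rewrite oppr_ge0 ltW.
exists q; split => [a x y|x|]; first by rewrite qD qZ.
  exact: le_trans (qpe x) (pep x).
apply/eqP; rewrite eq_le (le_trans (qpe e) (pep e))/=.
have [p0 _ _] := sp.
by have := le_trans (qpe (- e)) (pee (- e)); rewrite addNr p0 qN; lra.
Qed.

End Sublinear.

(** The function is the Minkowski gauge of [V]. Since [V] need not be symmetric, it is sublinear but
    in general no seminorm. *)
Lemma gauge_sublinear (E : tvsType R) (V : set E) : open V -> V 0 ->
  convex_subset V -> exists p : E -> R, [/\ sublinear p,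
    forall x, V x -> p x <= 1 & forall x, ~ V x -> 1 <= p x].
Proof.
move=> oV V0 cV; pose A x := [set t : R | 0 < t /\ V (t^-1 *: x)].
have A0 x : A x !=set0.
  have : nbhs (0 : E) V by exact: open_nbhs_nbhs.
  move=> /(near_line x) /nbhs_normP[d /= d0 dV].
  exists (d / 2)^-1; split; first by rewrite invr_gt0 divr_gt0.
  rewrite invrK; have := dV (d / 2); rewrite add0r; apply.
  by rewrite /= sub0r normrN gtr0_norm ?divr_gt0//; lra.
have lbA x : has_lbound (A x) by exists 0 => t [/ltW].
pose p x := inf (A x).
have pA x t : 0 < t -> V (t^-1 *: x) -> p x <= t.
  by move=> t0 Vt; apply: ge_inf.
have Ap x c : (forall t, 0 < t -> V (t^-1 *: x) -> c <= t) -> c <= p x.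
  by move=> h; apply: lb_le_inf => // t [t0 Vt]; exact: h.
exists p; split; first split.
- apply/eqP; rewrite eq_le; apply/andP; split; last by apply: (Ap) => t /ltW.
  by apply/ler_addgt0Pl => e e0; rewrite addr0; apply: pA => //; rewrite scaler0.
- move=> x y; rewrite -lerBlDl; apply: (Ap) => s s0 Vs.
  rewrite lerBlDl -lerBlDr; apply: (Ap) => t t0 Vt; rewrite lerBlDr.
  have ts0 : 0 < t + s by exact: addr_gt0.
  apply: pA => //.
  have := cV _ _ (t / (t + s)) Vt Vs.
  rewrite !scalerA scalerDr.
  have -> : t / (t + s) / t = (t + s)^-1 by field; rewrite !gt_eqF.
  have -> : (1 - t / (t + s)) / s = (t + s)^-1 by field; rewrite !gt_eqF.
  apply; rewrite divr_ge0 ?(ltW t0) ?(ltW ts0)//=.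
  by rewrite ler_pdivrMr// mul1r lerDl ltW.
- move=> r x r0; rewrite -ler_pdivrMl//; apply: (Ap) => t t0 Vt.
  rewrite ler_pdivrMl//; apply: pA; first exact: mulr_gt0.
  by rewrite scalerA invfM mulrAC mulVf ?gt_eqF// mul1r.
- by move=> x Vx; apply: pA; rewrite ?invr1 ?scale1r.
- move=> x nVx; apply: (Ap) => t t0 Vt; rewrite leNgt; apply/negP => t1; apply: nVx.
  have := cV _ _ t Vt V0; rewrite scalerA mulfV ?gt_eqF// scale1r scaler0 addr0.
  by apply; rewrite !ltW.
Qed.

(** The gauge of a convex neighbourhood [V] of 0 missing [e] is at least 1 at [e]. A functional
    below it is at most 1 on [V]; used for y - x and for x - y, this gives continuity. Division by
    its value at [e] normalises it. *)
Lemma separating_functional (Y : tvsType R) (e : Y) : hausdorff_space Y ->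
  e != 0 -> exists phi : Y -> R,
    [/\ forall a x y, phi (a *: x + y) = a * phi x + phi y,
        continuous phi & phi e = 1].
Proof.
move=> hY e0.
have e0' : 0 != e by rewrite eq_sym.
have [W [oW /set_mem W0 /set_mem We]] := hausdorff_accessible hY e0'.
have : nbhs (0 : Y) W by exact: open_nbhs_nbhs.
move=> /convex_nbhs[V [oV V0 VW cV]].
have [p [sp pV pnV]] := gauge_sublinear oV V0 cV.
have [phi [lphi phip phie]] := hahn_banach e sp.
have e1 : 1 <= phi e by rewrite phie; apply: pnV => /VW.
have ephi : 0 < phi e by exact: lt_le_trans e1.
have phiB x y : phi (x - y) = phi x - phi y.
  by rewrite addrC -scaleN1r lphi mulN1r addrC.
have phiZ a x : phi (a *: x) = a * phi x.
  have phi0 : phi 0 = 0 by have := phiB 0 0; rewrite !subrr.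
  by rewrite -[a *: x]addr0 lphi phi0 addr0.
have cphi : continuous phi.
  move=> x; apply/cvgrPdist_le => d d0.
  have dV : nbhs (0 : Y) V by exact: open_nbhs_nbhs.
  have h1 : (fun y => d^-1 *: (y - x)) @ x --> (0 : Y).
    rewrite -[X in _ --> X](scaler0 _ d^-1); apply: tvs_cvgZ; first exact: cvg_cst.
    by rewrite -[X in _ --> X](subrr x); apply: tvs_cvgB; [exact: cvg_id|exact: cvg_cst].
  have h2 : (fun y => d^-1 *: (x - y)) @ x --> (0 : Y).
    rewrite -[X in _ --> X](scaler0 _ d^-1); apply: tvs_cvgZ; first exact: cvg_cst.
    by rewrite -[X in _ --> X](subrr x); apply: tvs_cvgB; [exact: cvg_cst|exact: cvg_id].
  have n1 : nbhs x (fun y => V (d^-1 *: (y - x))) := h1 V dV.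
  have n2 : nbhs x (fun y => V (d^-1 *: (x - y))) := h2 V dV.
  apply: filterS2 n1 n2 => y V1 V2.
  have := le_trans (phip _) (pV _ V1); have := le_trans (phip _) (pV _ V2).
  rewrite !phiZ !phiB !ler_pdivrMl// !mulr1 => l1 l2.
  by rewrite ler_norml; apply/andP; split; lra.
exists (fun x => (phi e)^-1 * phi x); split.
- by move=> a x y; rewrite lphi mulrDr mulrCA.
- by move=> x; apply: cvgM; [exact: cvg_cst|exact: cphi].
- by rewrite mulVf// gt_eqF.
Qed.

End HahnBanach.

(** * Finite-dimensional spaces *)

(** Makes row vectors a [completeNormedModType], the Banach space with which a finite-dimensional
    space will be identified. *)
HB.instance Definition _ (R : realType) (m n : nat) :=
  Uniform_isComplete.Build 'M[R]_(m, n) (@cauchy_cvg 'M[R]_(m, n)).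

Section FiniteDimensional.
Context {R : realType}.
Implicit Types X Y : tvsType R.

Lemma lin_sum (X Y : lmodType R) (f : X -> Y) n (F : 'I_n -> X) : linear f ->
  f (\sum_(i < n) F i) = \sum_(i < n) f (F i).
Proof. by move=> lf; apply: (big_morph f) => [x y|]; [exact: linD|exact: lin0]. Qed.

(** A rank-one correction for each new vector e. If T e - T S T e is nonzero, a functional [phi]
    equal to 1 there gives S y + phi(y - T S y) (e - S T e): at T e this is e, and at T x with T S T
    x = T x nothing changes. *)
Lemma pseudo_inverse_on X Y (T : X -> Y) (s : seq X) :
  hausdorff_space Y -> linear T -> continuous T ->
  exists S : Y -> X, [/\ linear S, continuous S &
    {in s, forall x, T (S (T x)) = T x}].
Proof.
move=> hY lT cT; elim: s => [|e s [S [lS cS TST]]].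
  exists (fun=> 0); split => // [a x y|x]; first by rewrite scaler0 addr0.
  exact: cvg_cst.
have [r0|r0] := eqVneq (T e - T (S (T e))) 0.
  exists S; split => // x; rewrite inE => /predU1P[->|]; last exact: TST.
  by apply/esym/eqP; rewrite -subr_eq0 r0.
have [phi [lphi cphi phi1]] := separating_functional hY r0.
pose psi y := phi (y - T (S y)).
have lpsi a x y : psi (a *: x + y) = a * psi x + psi y.
  by rewrite -lphi /psi; congr phi; rewrite lS lT scalerBr opprD addrACA.
have cpsi : continuous psi.
  move=> y; apply: (@continuous_comp _ _ _ (fun y => y - T (S y)) phi); last exact: cphi.
  apply: tvs_cvgB; first exact: cvg_id.
  by apply: (@continuous_comp _ _ _ S T); [exact: cS|exact: cT].
have phi0 : phi 0 = 0.
  by have := lphi (-1) 0 0; rewrite scaler0 addr0 mulN1r addNr.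
exists (fun y => S y + psi y *: (e - S (T e))); split.
- move=> a x y; rewrite lS lpsi; move: (e - _) => w.
  by rewrite scalerDl scalerDr scalerA addrACA.
- move=> y; apply: tvs_cvgD; first exact: cS.
  by apply: tvs_cvgZ; [exact: cpsi|exact: cvg_cst].
- move=> x; rewrite inE linD// linZ// linB// => /predU1P[->|xs].
    by rewrite /psi phi1 scale1r subrKC.
  by rewrite /psi TST// subrr phi0 scale0r addr0.
Qed.

Lemma finite_dimensional_pseudo_inverse X Y (T : X -> Y) :
  finite_dimensional X -> hausdorff_space Y -> linear T -> continuous T ->
  exists S, pseudo_inverse T S.
Proof.
move=> [n [e spn]] hY lT cT.
have [S [lS cS TSTe]] := pseudo_inverse_on [seq e i | i : 'I_n] hY lT cT.
have TST x : T (S (T x)) = T x.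
  have [c ->] := spn x; rewrite !lin_sum//; apply: eq_bigr => i _.
  by rewrite !linZ// TSTe//; exact: codom_f.
(* Passing from S to S T S secures the second identity of a pseudo-inverse. *)
exists (fun y => S (T (S y))); split.
- by move=> a x y; rewrite lS lT lS.
- by apply: (@comp_continuous _ _ _ (T \o S) S) => //; exact: (@comp_continuous _ _ _ S T).
- by move=> x; rewrite !TST.
- by move=> y; rewrite !TST.
Qed.

Lemma tvs_sum_continuous X (T : topologicalType) n (F : 'I_n -> T -> X) :
  (forall i, continuous (F i)) -> continuous (fun x => \sum_(i < n) F i x).
Proof.
move=> cF x; elim: n F cF => [|n IH] F cF.
  rewrite (_ : (fun x => _) = fun=> 0); first exact: cvg_cst.
  by apply/funext => y; rewrite big_ord0.
rewrite (_ : (fun x => _) =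
  fun y => \sum_(i < n) F (widen_ord (leqnSn n) i) y + F ord_max y); last first.
  by apply/funext => y; rewrite big_ord_recr.
apply: tvs_cvgD; last exact: cF.
by apply: (IH (fun i => F (widen_ord (leqnSn n) i))) => i; exact: cF.
Qed.

(** A spanning family of minimal length is a basis, so the coordinate map from row vectors is a
    continuous bijection. Its pseudo-inverse, obtained from Hahn--Banach, must be its inverse, which
    is therefore continuous. *)
Lemma finite_dimensional_banach X : hausdorff_space X ->
  finite_dimensional X -> banach_space X.
Proof.
move=> hX fX.
have ex : exists n, `[< exists e : 'I_n -> X,
    forall x, exists c : 'I_n -> R, x = \sum_(i < n) c i *: e i >].
  by have [n h] := fX; exists n; exact/asboolP.
case: (ex_minnP ex) => n /asboolP[e spn] nmin.
pose T (c : 'rV[R]_n) : X := \sum_(i < n) c 0 i *: e i.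
have lT : linear T.
  move=> a c d; rewrite /T scaler_sumr -big_split; apply: eq_bigr => i _ /=.
  by rewrite !mxE scalerDl scalerA.
have cT : continuous T.
  apply: tvs_sum_continuous => i c; 
  apply: (@continuous_comp _ _ _ (fun c : 'rV[R]_n => c 0 i) (fun t => t *: e i)).
    exact: coord_continuous.
  by apply: tvs_cvgZ; [exact: cvg_id|exact: cvg_cst].
(* A relation with nonzero coefficient at j would eliminate e_j, contradicting the minimality of
   n. *)
have T0 c : T c = 0 -> c = 0.
  move=> Tc0; apply/rowP => j; rewrite mxE; apply/eqP/negPn/negP => cj0.
  case: n e spn nmin @T lT cT c Tc0 j cj0 => [|m] e spn nmin T lT cT c Tc0 j cj0.
    by case: j cj0.
  suff h : `[< exists e' : 'I_m -> X,
    forall x, exists c : 'I_m -> R, x = \sum_(i < m) c i *: e' i >].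
    by have := nmin m h; rewrite ltnn.
  apply/asboolP; exists (fun i => e (lift j i)) => x.
  have [d ->] := spn x.
  exists (fun i => d (lift j i) - d j / c 0 j * c 0 (lift j i)).
  rewrite (bigD1_ord j)//=.
  have cE : \sum_(i < m) c 0 (lift j i) *: e (lift j i) = - (c 0 j *: e j).
    apply/eqP; rewrite -subr_eq0 opprK addrC; apply/eqP.
    by rewrite -[RHS]Tc0 /T (bigD1_ord j).
  have -> : d j *: e j =
      - ((d j / c 0 j) *: \sum_(i < m) c 0 (lift j i) *: e (lift j i)).
    by rewrite cE scalerN opprK scalerA divfK.
  rewrite scaler_sumr addrC -sumrB; apply: eq_bigr => i _.
  by rewrite scalerBl scalerA.
have Tinj c d : T c = T d -> c = d.
  by move=> e0; apply/eqP; rewrite -subr_eq0; apply/eqP/T0; rewrite linB// e0 subrr.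
have fV : finite_dimensional ('rV[R]_n : normedModType R).
  exists n, (fun i => delta_mx 0 i) => c; exists (fun i => c 0 i).
  exact: row_sum_delta.
have [S [lS cS TST STS]] := finite_dimensional_pseudo_inverse fV hX lT cT.
have ST c : S (T c) = c by apply: Tinj; rewrite TST.
have TS x : T (S x) = x.
  have [c ->] := spn x.
  have -> : \sum_(i < n) c i *: e i = T (\row_i c i).
    by apply: eq_bigr => i _; rewrite mxE.
  exact: TST.
pose TL : {linear 'rV[R]_n -> X} := HB.pack T (GRing.isLinear.Build R 'rV[R]_n X _ T lT).
by exists 'rV[R]_n, TL, S.
Qed.

End FiniteDimensional.

(** * Charts *)

Section Charts.
Context {R : realType}.
Implicit Types X Y Z : tvsType R.

Lemma smooth_comp X Y Z (U : set X) (V : set Y) (f : X -> Y) (g : Y -> Z) :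
  hausdorff_space X -> hausdorff_space Y -> hausdorff_space Z ->
  open U -> open V -> (forall x, U x -> V (f x)) ->
  smooth_on U f -> smooth_on V g -> smooth_on U (g \o f).
Proof. by move=> hX hY hZ oU oV UV sf sg n; exact: (Ck_comp hX hY hZ oU oV UV). Qed.

Lemma gderive_continuous X Y (U : set X) (f : X -> Y) x :
  Ck_on 1 U f -> U x -> continuous (gderive f x).
Proof.
move=> [_ [_ [cf _]]] Ux v.
apply: (@continuous_comp _ _ _ (fun v => (x, v)) (fun p => gderive f p.1 p.2)).
  by apply: cvg_pair; [exact: cvg_cst|exact: cvg_id].
by apply: cf; exact/mem_set.
Qed.

Section ChartComp.
Variables (M : topologicalType) (X Z : tvsType R) (c : chart M X) (d : chart X Z).

(** Kept transparent, since later proofs unfold its domains and maps by conversion. *)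
Definition chart_comp : chart M Z.
Proof.
pose D := [set m | chart_dom c m /\ chart_dom d (chart_map c m)].
pose C := [set z | chart_cod d z /\ chart_cod c (chart_inv d z)].
apply: (@Chart R M Z D C (fun m => chart_map d (chart_map c m))
  (fun z => chart_inv c (chart_inv d z))).
- apply: open_preimage_in; [exact: chart_dom_open| |exact: chart_dom_open].
  exact: chart_map_continuous.
- apply: open_preimage_in; [exact: chart_cod_open| |exact: chart_cod_open].
  exact: chart_inv_continuous.
- move=> m [cm dm]; split; first exact: chart_mapP.
  by rewrite chart_mapK//; exact: chart_mapP.
- move=> z [dz cz]; split; first exact: chart_invP.
  by rewrite chart_invK//; exact: chart_invP.
- by move=> m [cm dm]; rewrite !chart_mapK.
- by move=> z [dz cz]; rewrite !chart_invK.
- move=> m /set_mem[cm dm].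
  apply: (@continuous_comp _ _ _ (chart_map c) (chart_map d));
    by apply: chart_map_continuous; exact/mem_set.
- move=> z /set_mem[dz cz].
  apply: (@continuous_comp _ _ _ (chart_inv d) (chart_inv c));
    by apply: chart_inv_continuous; exact/mem_set.
Defined.

End ChartComp.

Definition smooth_chart X Z (d : chart X Z) : Prop :=
  smooth_on (chart_dom d) (chart_map d) /\ smooth_on (chart_cod d) (chart_inv d).

Lemma open_transition (M : topologicalType) X Y (c : chart M X) (d : chart M Y) :
  open [set x | chart_cod c x /\ chart_dom d (chart_inv c x)].
Proof.
apply: open_preimage_in; [exact: chart_cod_open|exact: chart_inv_continuous|].
exact: chart_dom_open.
Qed.

Lemma compatible_chart_comp (M : manifold R) X Z (c : chart M X) (d : chart X Z) :
  hausdorff_space X -> hausdorff_space Z -> compatible_chart c ->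
  smooth_chart d -> compatible_chart (chart_comp c d).
Proof.
move=> hX hZ cc [sd sdi] i; have hi := @mfd_model_hausdorff R M i.
have [ci ic] := cc i; split.
- apply: (@smooth_comp _ _ _ _ _ (chart_inv d) (chart_map (mfd_chart M i) \o chart_inv c)
    hZ hX hi _ (open_transition c (mfd_chart M i))) => //.
  + exact: open_transition.
  + by move=> z [[_ ?] ?].
  + by move=> n; apply: Ck_sub (sdi n) => z [[]].
- apply: (@smooth_comp _ _ _ _ _ (chart_map c \o chart_inv (mfd_chart M i)) (chart_map d)
    hi hX hZ _ (chart_dom_open d)) => //.
  + exact: open_transition.
  + by move=> z [_ []].
  + by move=> n; apply: Ck_sub (ic n) => z [? []].
Qed.

Lemma mfd_chart_compatible (M : manifold R) i : compatible_chart (mfd_chart M i).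
Proof. by move=> j; split; exact: mfd_compat. Qed.

(** Composing a chart with it restricts that chart to the points with coordinates in [O]. *)
Definition id_chart X (O : set X) (oO : open O) : chart X X.
Proof.
by apply: (@Chart R X X O O id id oO oO) => // x _; exact: cvg_id.
Defined.

Lemma Ck_id X (U : set X) n : hausdorff_space X -> Ck_on n U (id : X -> X).
Proof. by move=> hX; apply: Ck_linear => // x; exact: cvg_id. Qed.

Section AffineChart.
Variables (X Z : tvsType R) (phi : Z -> X) (psi : X -> Z) (a : X).
Hypotheses (phiK : cancel phi psi) (psiK : cancel psi phi).
Hypotheses (cphi : continuous phi) (cpsi : continuous psi).

(** Serves two adjustments of an atlas chart: centring it at a point, and replacing a model space
    that is only isomorphic to a complete normed space by that normed space. *)
Definition affine_chart : chart X Z.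
Proof.
apply: (@Chart R X Z setT setT (fun x => psi (x - a)) (fun z => phi z + a)) => //.
- exact: openT.
- exact: openT.
- by move=> x _; rewrite psiK subrK.
- by move=> z _; rewrite addrK phiK.
- move=> x _; apply: (@continuous_comp _ _ _ (fun x => x - a) psi); last exact: cpsi.
  by apply: tvs_cvgB; [exact: cvg_id|exact: cvg_cst].
- by move=> z _; apply: tvs_cvgD; [exact: cphi|exact: cvg_cst].
Defined.

Lemma smooth_affine_chart : hausdorff_space X -> hausdorff_space Z -> linear phi ->
  linear psi -> smooth_chart affine_chart.
Proof.
move=> hX hZ lphi lpsi; split => n.
  apply: (@Ck_comp _ _ _ _ n setT setT (fun x => x - a) psi) => //=; try exact: openT.
  - apply: Ck_D => //; [exact: openT|exact: Ck_id|exact: Ck_cst].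
  - exact: Ck_linear.
by apply: Ck_D => //; [exact: openT|exact: Ck_linear|exact: Ck_cst].
Qed.

End AffineChart.

End Charts.

(** * Normal forms *)

Section LocalNormalForm.
Context {R : realType}.

Lemma local_normal_form (B : completeNormedModType R) (Y : tvsType R)
    (U : set B) (F : B -> Y) (S : Y -> B) :
  hausdorff_space Y -> open U -> U 0 -> smooth_on U F -> F 0 = 0 ->
  pseudo_inverse (gderive F 0) S ->
  exists (nf : normal_form R) (c : chart B (nf_X nf)) (d : chart Y (nf_Y nf)),
  [/\ smooth_chart c /\ smooth_chart d,
      chart_dom c 0 /\ chart_map c 0 = 0,
      chart_dom d 0 /\ chart_map d 0 = 0,
      (forall x, chart_dom c x -> U x /\ chart_dom d (F x)) &
      chart_cod c `<=` nf_dom nf /\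
      forall x1 x2, nf_ker nf x1 -> nf_coim nf x2 -> chart_cod c (x1 + x2) ->
        chart_map d (F (chart_inv c (x1 + x2))) =
          nf_hat nf x2 + nf_sing nf (x1 + x2)].
Proof.
move=> hY oU U0 sF F0 [lS cS TST STS].
have hB : hausdorff_space B by exact: norm_hausdorff.
have lT : linear (gderive F 0) by exact: gderive_linear hY oU (sF 1) U0.
have cT : continuous (gderive F 0) by exact: gderive_continuous (sF 1) U0.
have dFT v := gderivableP ((sF 1).2.1 0 v U0); have C1F := sF 1.
set T := gderive F 0 in lT cT TST STS dFT.
have cST : continuous (fun x => S (T x)) by exact: comp_continuous.
have cTS : continuous (fun y => T (S y)) by exact: comp_continuous.
have lST : linear (fun x => S (T x)) by exact: (linear_comp lT lS).
have lTS : linear (fun y => T (S y)) by exact: (linear_comp lS lT).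
(* [x - h x = x - S (T x) + S (F x)] straightens [F] modulo [ker S]. *)
pose h x := S (T x - F x).
have sh : smooth_on U h.
  apply: (@smooth_comp _ _ _ _ _ setT (fun x => T x - F x) S) => //.
  - exact: openT.
  - by move=> n; apply: Ck_B => //; exact: Ck_linear.
  - by move=> n; exact: Ck_linear.
have h0 : h 0 = 0 by rewrite /h F0 subr0 !lin0.
have dh0 v : gderive h 0 v = 0.
  apply: diff_quotient_unique => //.
  rewrite (diff_quotient_comp_linear (fun x => T x - F x) _ _ lS) diff_quotientB.
  have e : S (T v - T v) = 0 by rewrite subrr lin0.
  rewrite -[X in _ --> X]e; apply: (@cvg_comp _ _ _ _ S _ (nbhs (T v - T v))); last exact: cS.
  exact: (tvs_cvgB (@diff_quotient_linear _ _ _ T 0 v lT) (dFT v)).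
have [c [c0 cU cm cinv]] := inverse_function oU U0 sh h0 dh0.
pose V := chart_cod c; have oV : open V by exact: chart_cod_open.
have cm0 : chart_map c 0 = 0 by rewrite cm h0 subr0.
have V0 : V 0 by rewrite -cm0; exact: chart_mapP.
have ci0 : chart_inv c 0 = 0 by rewrite -{1}cm0 chart_mapK.
pose G z := F (chart_inv c z).
have sG : smooth_on V G.
  apply: (smooth_comp hB hB hY oV oU _ cinv sF).
  by move=> z Vz; apply: cU; exact: chart_invP.
(* With z = x - S(T x - F x), the identity S T S = S gives S T z = S F x. *)
have SG z : V z -> S (G z) = S (T z).
  move=> Vz; have := chart_invK Vz; rewrite cm /h /G; move: (chart_inv c z) => x <-.
  by rewrite (linB _ _ lT) (linB _ _ lS) STS (linB _ _ lS) opprB subrKC.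
(* The part of [G] in the kernel of S; by [SG] the remaining part T S G z is T z, so G = T + g on
   [V]. *)
pose g z := G z - T (S (G z)).
have Sg z : S (g z) = 0 by rewrite /g (linB _ _ lS) STS subrr.
have sg : smooth_on V g.
  apply: (@smooth_comp _ _ _ _ _ setT G (fun y => y - T (S y))) => //.
  - exact: openT.
  - move=> n; apply: Ck_linear => //.
      by move=> a x y; rewrite lTS scalerBr opprD addrACA.
    by move=> y; apply: tvs_cvgB; [exact: cvg_id|exact: cTS].
have G0 : G 0 = 0 by rewrite /G ci0.
have g0 : g 0 = 0 by rewrite /g G0 (lin0 lS) (lin0 lT) subrr.
(* The chain rule for the chart after its inverse, together with the fact that the chart has
   derivative 1 at 0. *)
have dci v : gderive (chart_inv c) 0 v = v.
  have dc w : gderive (chart_map c) 0 w = w.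
    rewrite cm; apply: diff_quotient_unique => //.
    rewrite (@diff_quotientB _ _ _ id).
    rewrite -[X in _ --> X]subr0 -[X in _ --> _ - X](dh0 w).
    apply: tvs_cvgB; first exact: (@diff_quotient_linear _ _ _ id).
    by apply: gderivableP; apply: (sh 1).2.1.
  have C1c : Ck_on 1 (chart_dom c) (chart_map c).
    by rewrite cm; apply: Ck_B => //; [exact: chart_dom_open|exact: Ck_id|exact: Ck_sub (sh 1)].
  have c0' : chart_dom c (chart_inv c 0) by rewrite ci0.
  have := gderive_comp hB hB (chart_dom_open c) C1c c0' ((cinv 1).2.1 0 v V0).
  rewrite ci0 dc => e.
  apply: (cvg_unique hB e); apply: (@diff_quotient_near _ _ _ id).
    by apply: (open_near_eq oV) V0 => z /set_mem Vz /=; rewrite chart_invK.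
  exact: (@diff_quotient_linear _ _ _ id).
have dg v : diff_quotient g 0 v @ 0^' --> (0 : Y).
  have dG : diff_quotient G 0 v @ 0^' --> T v.
    have Uc0 : U (chart_inv c 0) by rewrite ci0.
    by have := gderive_comp hB hY oU C1F Uc0 ((cinv 1).2.1 0 v V0); rewrite ci0 dci.
  rewrite diff_quotientB (diff_quotient_comp_linear G _ _ lTS).
  rewrite -[X in _ --> X](subrr (T v)) -[X in _ --> _ - X]TST.
  apply: tvs_cvgB => //.
  exact: (@cvg_comp _ _ _ (diff_quotient G 0 v) (fun y => T (S y)) _ _ _ dG (cTS (T v))).
(* As S g = 0, adding or subtracting g(S y) leaves S y unchanged; hence both maps preserve [W] and
   invert each other. *)
pose W := [set y | V (S y)].
have oW : open W by move/continuousP: cS; apply.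
have sgS : smooth_on W (fun y => g (S y)).
  apply: (@smooth_comp _ _ _ _ W V S g) => //.
  by move=> n; exact: Ck_linear.
have s1 : smooth_on W (fun y => y - g (S y)).
  by move=> n; apply: Ck_B => //; exact: Ck_id.
have s2 : smooth_on W (fun y => y + g (S y)).
  by move=> n; apply: Ck_D => //; exact: Ck_id.
have S1 y : S (y - g (S y)) = S y by rewrite (linB _ _ lS) Sg subr0.
have S2 y : S (y + g (S y)) = S y by rewrite (linD _ _ lS) Sg addr0.
have W1 y : W y -> W (y - g (S y)) by rewrite /W/= S1.
have W2 y : W y -> W (y + g (S y)) by rewrite /W/= S2.
have K1 y : W y -> (y - g (S y)) + g (S (y - g (S y))) = y.
  by rewrite S1 subrK.
have K2 y : W y -> (y + g (S y)) - g (S (y + g (S y))) = y.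
  by rewrite S2 addrK.
pose d := @Chart R Y Y W W (fun y => y - g (S y)) (fun y => y + g (S y))
  oW oW W1 W2 K1 K2 (Ck_continuous (s1 0)) (Ck_continuous (s2 0)).
(* The second condition makes g(S T z) meaningful and, since S G z = S T z, puts G z into [W]. *)
pose O := [set z | V z /\ V (S (T z))].
have oO : open O by apply: open_preimage_in => // z _; exact: cST.
have O0 : O 0 by split=> //; rewrite (lin0 lT) (lin0 lS).
(* On the fixed points of S T, which form coim, both terms agree; everywhere the value is killed by
   S and so lies in coker. *)
pose sing z := g z - g (S (T z)).
have ssing : smooth_on O sing.
  move=> n; apply: Ck_B => //; first by apply: Ck_sub (sg n) => z [].
  apply: (@Ck_comp _ _ _ _ n O W T (fun y => g (S y))) => //.
    by move=> z [].
  exact: Ck_linear.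
have Xsum : topological_sum [set x | S (T x) = 0] [set x | S (T x) = x].
  by apply: (@continuous_linear_projection_sum R B (fun x => S (T x))).
have Ysum : topological_sum [set y | T (S y) = 0] [set y | T (S y) = y].
  by apply: (@continuous_linear_projection_sum R Y (fun y => T (S y))).
have hatbij : set_bij [set x | S (T x) = x] [set y | T (S y) = y] T.
  split.
  - by move=> x _; rewrite /= TST.
  - by move=> x y /set_mem/= xE /set_mem/= yE Txy; rewrite -xE -yE Txy.
  - by move=> y /= yE; exists (S y) => //=; rewrite STS.
have hatinv : exists2 k : Y -> B, {in [set x | S (T x) = x], cancel T k} &
    {within [set y | T (S y) = y], continuous k}.
  by exists S; [move=> x /set_mem|exact: continuous_subspaceT].
have singcoker z : O z -> T (S (sing z)) = 0.
  by move=> _; rewrite /sing (linB _ _ lS) !Sg subrr (lin0 lT).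
have singcoim z : O z -> S (T z) = z -> sing z = 0.
  by move=> _ zE; rewrite /sing zE subrr.
have dsing v : gderive sing 0 v = 0.
  apply: diff_quotient_unique => //.
  rewrite diff_quotientB (_ : diff_quotient (fun z => g (S (T z))) 0 v =
    diff_quotient g 0 (S (T v))); last first.
    apply/funext => t; rewrite /diff_quotient !add0r (linZ _ _ lST).
    by rewrite (lin0 lT) (lin0 lS).
  by rewrite -[X in _ --> X](subrr 0); apply: tvs_cvgB.
pose nf := @NormalForm R B Y hB hY _ _ _ _ Xsum Ysum T
  (fun a x y _ _ => lT a x y) hatbij (continuous_subspaceT cT) hatinv O oO O0 sing
  singcoker ssing singcoim dsing.
exists nf, (chart_comp c (id_chart oO)), d.
have sc : smooth_chart c.
  split=> // n; rewrite cm.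
  by apply: Ck_B => //; [exact: chart_dom_open|exact: Ck_id|exact: Ck_sub (sh n)].
have Gx x : chart_dom c x -> G (chart_map c x) = F x.
  by move=> cx; rewrite /G chart_mapK.
split.
- split; last by split.
  split=> n.
    apply: Ck_sub (sc.1 n); first by move=> x [].
  by apply: Ck_sub (sc.2 n) => x [].
- by split => //=; split=> //; rewrite cm0.
- by split; rewrite /= ?/W/= (lin0 lS)// g0 subr0.
- move=> x [cx [Vx VSTx]]; split; first exact: cU.
  by rewrite /=/W/= -Gx// SG.
split; first by move=> z [].
move=> x1 x2 /= k1 k2 [Oz Vz]; set z := x1 + x2 in Oz Vz *.
(* T x1 = T S T x1 = 0. The claim then reads G z - g(S G z) = T x2 + g z - g(S T z), by G = T + g
   and S G = S T. *)
have Tz : T z = T x2 by rewrite /z (linD _ _ lT) -[T x1]TST k1 (lin0 lT) add0r.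
rewrite -/(G z) SG// /sing addrA; congr (_ - _).
by rewrite /g SG// TST Tz subrKC.
Qed.

End LocalNormalForm.

(** * Changes of charts and the two implications *)

Section Main.
Context {R : realType}.
Implicit Types X Y : tvsType R.

(** The chain rule applied to a composite that is the identity near the point. Swapping the two
    charts gives the other cancellation. *)
Lemma transition_derivative (M : topologicalType) X Y (c : chart M X) (d : chart M Y)
    (m : M) : hausdorff_space X -> hausdorff_space Y ->
  smooth_transition c d -> smooth_transition d c ->
  chart_dom c m -> chart_dom d m ->
  let D := gderive (chart_map d \o chart_inv c) (chart_map c m) in
  let D' := gderive (chart_map c \o chart_inv d) (chart_map d m) in
  [/\ linear D, continuous D & cancel D D'].
Proof.
move=> hX hY cd dc cm dm D D'.
have oU := open_transition c d; have oV := open_transition d c.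
have Um : [set x | chart_cod c x /\ chart_dom d (chart_inv c x)] (chart_map c m).
  by split; [exact: chart_mapP|rewrite chart_mapK].
have E : (chart_map d \o chart_inv c) (chart_map c m) = chart_map d m.
  by rewrite /= chart_mapK.
have Vm : [set x | chart_cod d x /\ chart_dom c (chart_inv d x)]
    ((chart_map d \o chart_inv c) (chart_map c m)).
  by rewrite E; split; [exact: chart_mapP|rewrite chart_mapK].
split.
- exact: gderive_linear hY oU (cd 1) Um.
- exact: gderive_continuous (cd 1) Um.
move=> v; have := gderive_comp hY hX oV (dc 1) Vm ((cd 1).2.1 _ v Um).
rewrite E -/D -/(D' _) => e.
apply: (cvg_unique hX e); apply: (@diff_quotient_near _ _ _ id); last first.
  exact: (@diff_quotient_linear _ _ _ id).
apply: (open_near_eq oU) Um => x /set_mem[cx dx] /=.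
by rewrite chart_mapK// chart_invK.
Qed.

(** As [nf_hat] is meaningful on coim only, it is precomposed with the projection [q] onto coim
    along ker; the pseudo-inverse is the inverse of [nf_hat] after the projection onto im. *)
Lemma nf_hat_pseudo_inverse (nf : normal_form R) : exists q : nf_X nf -> nf_X nf,
  [/\ forall x, nf_ker nf (x - q x), forall x, nf_coim nf (q x),
      linear (nf_hat nf \o q), continuous (nf_hat nf \o q) &
      exists S, pseudo_inverse (nf_hat nf \o q) S].
Proof.
have [q [lq cq kq Cq qE]] := topological_sum_proj (nf_X_sum nf).
have [p [lp cp cokp Ip pE]] := topological_sum_proj (nf_Y_sum nf).
have [_ [_ lC] _ _] := nf_X_sum nf; have [[coker0 _] [_ lI] _ _] := nf_Y_sum nf.
have [hatI hat_inj hat_surj] := nf_hat_bij nf.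
have [g gK cg] := nf_hat_inv_continuous nf.
have ker0 : nf_ker nf 0 by have [[]] := nf_X_sum nf.
have qK x : nf_coim nf x -> q x = x by move=> Cx; rewrite -{1}[x]add0r qE.
have pK y : nf_im nf y -> p y = y by move=> Iy; rewrite -{1}[y]add0r pE.
have gI y : nf_im nf y -> nf_coim nf (g y) /\ nf_hat nf (g y) = y.
  by move=> /hat_surj[x Cx <-]; rewrite gK//; exact/mem_set.
exists q; split => //.
- by move=> a x y; rewrite /= lq nf_hat_linear.
- exact: (continuous_within_comp cq Cq (@nf_hat_continuous _ nf)).
exists (g \o p); split => /=.
- move=> a x y; have [Cx hx] := gI _ (Ip x); have [Cy hy] := gI _ (Ip y).
  have [Cz hz] := gI _ (Ip (a *: x + y)).
  apply: hat_inj; [exact/mem_set|by apply/mem_set; exact: lC|].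
  by rewrite hz nf_hat_linear// hx hy lp.
- exact: (continuous_within_comp cp Ip cg).
- move=> x; rewrite (pK _ (hatI _ (Cq x))) gK; last by apply/mem_set.
  by rewrite (qK _ (Cq x)).
- move=> y; have [Cy hy] := gI _ (Ip y).
  by rewrite (qK _ Cy) hy (pK _ (Ip y)).
Qed.

(** The derivative of f_NF at 0 is [nf_hat] after [q], because that of [nf_sing] vanishes. The
    tangent map is A T0 B with A and B invertible derivatives of transitions, and B' S0 A' is a
    pseudo-inverse of it. *)
Lemma normal_form_tangent_regular (M N : manifold R) (f : M -> N) (m : M) :
  has_normal_form f m -> regular_operator (tangent_map f m).
Proof.
move=> [nf [kappa [rho [[ck km k0] [cr rm r0] frho knf fE]]]].
have [hX hY] := (@nf_X_hausdorff _ nf, @nf_Y_hausdorff _ nf).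
pose i := tangent_index m; pose j := tangent_index (f m).
pose phi := mfd_chart M i; pose psi := mfd_chart N j.
have hi : hausdorff_space (mfd_model M i) by exact: mfd_model_hausdorff.
have hj : hausdorff_space (mfd_model N j) by exact: mfd_model_hausdorff.
have pm : chart_dom phi m by exact: (projT2 (cid (mfd_cover m))).
have sm : chart_dom psi (f m) by exact: (projT2 (cid (mfd_cover (f m)))).
have [q [kq Cq lT0 cT0 [S0 [lS0 cS0 TST0 STS0]]]] := nf_hat_pseudo_inverse nf.
have [kphi phik] := ck i; have [rpsi psir] := cr j.
have [lB cB BK] := transition_derivative hi hX phik kphi pm km.
have [lB' cB' B'K] := transition_derivative hX hi kphi phik km pm.
have [lA cA AK] := transition_derivative hY hj rpsi psir rm sm.
have [lA' cA' A'K] := transition_derivative hj hY psir rpsi sm rm.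
set B := gderive _ _ in lB cB BK B'K; set B' := gderive _ _ in lB' cB' BK B'K.
set A := gderive _ _ in lA cA AK A'K; set A' := gderive _ _ in lA' cA' AK A'K.
set T0 := _ \o q in lT0 cT0 TST0 STS0.
pose G z := T0 z + nf_sing nf z.
have G1 : Ck_on 1 (nf_dom nf) G.
  apply: Ck_D => //; [exact: nf_dom_open|exact: Ck_linear|exact: nf_sing_smooth].
have GE z : chart_cod kappa z -> chart_map rho (f (chart_inv kappa z)) = G z.
  move=> zk; have := fE (z - q z) (q z) (kq z) (Cq z).
  by rewrite subrK => /(_ zk).
have dG v : gderive G 0 v = T0 v.
  apply: diff_quotient_unique => //.
  rewrite [X in X @ _](_ : _ = (fun t =>
    diff_quotient T0 0 v t + diff_quotient (nf_sing nf) 0 v t)); last first.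
    apply/funext => t; rewrite /diff_quotient -scalerDr; congr (_ *: _).
    by rewrite /G opprD addrACA.
  rewrite -[X in _ --> X]addr0 -[X in _ --> _ + X](nf_sing_derive (n := nf) v).
  apply: tvs_cvgD; first exact: diff_quotient_linear.
  by apply: gderivableP; apply: (@nf_sing_smooth _ nf 1).2.1; exact: nf_dom0.
have TE v : tangent_map f m v = A (T0 (B v)).
  pose t1 := chart_map kappa \o chart_inv phi.
  have t1m : t1 (chart_map phi m) = 0 by rewrite /t1 /= chart_mapK.
  have Um : [set x | chart_cod phi x /\ chart_dom kappa (chart_inv phi x)] (chart_map phi m).
    by split; [exact: chart_mapP|rewrite chart_mapK].
  have G0 : G 0 = 0.
    rewrite -GE; first by rewrite -k0 chart_mapK.
    by rewrite -k0; exact: chart_mapP.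
  have d1 : gderivable t1 (chart_map phi m) v by apply: (phik 1).2.1.
  have d2 : diff_quotient (G \o t1) (chart_map phi m) v @ 0^' --> T0 (B v).
    have nd : nf_dom nf (t1 (chart_map phi m)) by rewrite t1m; exact: nf_dom0.
    have := gderive_comp hX hY (@nf_dom_open _ nf) G1 nd d1.
    by rewrite t1m dG.
  have Vm : [set y | chart_cod rho y /\ chart_dom psi (chart_inv rho y)]
      ((G \o t1) (chart_map phi m)).
    rewrite /= t1m G0 -r0; split; first exact: chart_mapP.
    by rewrite chart_mapK.
  have gd2 : gderivable (G \o t1) (chart_map phi m) v by exists (T0 (B v)).
  have := gderive_comp hY hj (open_transition rho psi) (rpsi 1) Vm gd2.
  rewrite (diff_quotient_unique hY d2) [(G \o t1) _]/= t1m G0 -{1}r0 -/A => d3.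
  apply: diff_quotient_unique => //; apply: diff_quotient_near d3.
  apply: (open_near_eq (open_transition phi kappa)) Um => x /set_mem[xp xk] /=.
  rewrite -GE; last exact: chart_mapP.
  rewrite chart_mapK// chart_mapK//; apply: frho.
  by exists (chart_inv phi x).
have tE : tangent_map f m = fun v => A (T0 (B v)) by apply/funext.
have lT : linear (fun v => A (T0 (B v))) by exact: (linear_comp (linear_comp lB lT0) lA).
have cT : continuous (fun v => A (T0 (B v))).
  exact: (@comp_continuous _ _ _ (T0 \o B) A (comp_continuous cB cT0) cA).
rewrite tE; apply: (pseudo_inverse_regular hi hj lT cT (S := fun w => B' (S0 (A' w)))).
split.
- exact: (linear_comp (linear_comp lA' lS0) lB').
- exact: (@comp_continuous _ _ _ (S0 \o A') B' (comp_continuous cA' cS0) cB').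
- by move=> x; rewrite B'K AK TST0.
- by move=> y; rewrite B'K AK STS0.
Qed.

Lemma tangent_map_linear_continuous (M N : manifold R) (f : M -> N) (m : M) :
  smooth_map f -> linear (tangent_map f m) /\ continuous (tangent_map f m).
Proof.
move=> [cf sf].
pose phi := mfd_chart M (tangent_index m); pose psi := mfd_chart N (tangent_index (f m)).
have pm : chart_dom phi m by exact: (projT2 (cid (mfd_cover m))).
have sm : chart_dom psi (f m) by exact: (projT2 (cid (mfd_cover (f m)))).
have hj : hausdorff_space (tangent_space (f m)) by exact: mfd_model_hausdorff.
pose U := [set x | chart_cod phi x /\ chart_dom psi (f (chart_inv phi x))].
have oU : open U.
  apply: (@open_preimage_in _ _ (f \o chart_inv phi)); last exact: chart_dom_open.
    exact: chart_cod_open.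
  move=> x xp; apply: continuous_comp; last exact: cf.
  exact: chart_inv_continuous.
have Um : U (chart_map phi m) by split; [exact: chart_mapP|rewrite chart_mapK].
split; first exact: (gderive_linear hj oU (sf _ _ 1) Um).
exact: (gderive_continuous (sf _ _ 1) Um).
Qed.

(** The hypothesis is a pseudo-inverse instead of regularity, so that the finite-dimensional case
    can supply one directly. Since the charts extend those defining the tangent spaces, F'(0) is the
    tangent map after [phiL]. *)
Lemma regular_tangent_normal_form (M N : manifold R) (f : M -> N) (m : M) :
  banach_space (tangent_space m) -> smooth_map f ->
  (exists S, pseudo_inverse (tangent_map f m) S) -> has_normal_form f m.
Proof.
move=> [B [phiL [psiL [K1 K2 c1 c2]]]] [cf sf] [S [lS cS TST STS]].
pose i := tangent_index m; pose j := tangent_index (f m).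
pose phi := mfd_chart M i; pose psi := mfd_chart N j.
have hi : hausdorff_space (mfd_model M i) by exact: mfd_model_hausdorff.
have hj : hausdorff_space (mfd_model N j) by exact: mfd_model_hausdorff.
have hB : hausdorff_space B by exact: norm_hausdorff.
have pm : chart_dom phi m by exact: (projT2 (cid (mfd_cover m))).
have sm : chart_dom psi (f m) by exact: (projT2 (cid (mfd_cover (f m)))).
have l1 : linear phiL by move=> a x y; rewrite linearP.
have l2 : linear psiL.
  by move=> a x y; apply: (can_inj K1); rewrite l1 !K2.
have cid' (X : tvsType R) : continuous (id : X -> X) by move=> x; exact: cvg_id.
pose a := chart_map phi m; pose b := chart_map psi (f m).
pose e1 : chart (mfd_model M i) B := affine_chart a K1 K2 c1 c2.
pose e2 : chart (mfd_model N j) (mfd_model N j) :=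
  affine_chart b (fun _ => erefl) (fun _ => erefl) (@cid' _) (@cid' _).
have se1 : smooth_chart e1 by exact: smooth_affine_chart.
have se2 : smooth_chart e2 by exact: smooth_affine_chart.
pose c0 := chart_comp phi e1; pose d0 := chart_comp psi e2.
have cc0 : compatible_chart c0.
  by apply: compatible_chart_comp => //; exact: mfd_chart_compatible.
have cd0 : compatible_chart d0.
  by apply: compatible_chart_comp => //; exact: mfd_chart_compatible.
pose F : B -> mfd_model N j := chart_map d0 \o f \o chart_inv c0.
pose G := chart_map psi \o f \o chart_inv phi.
pose V := [set x | chart_cod phi x /\ chart_dom psi (f (chart_inv phi x))].
have oV : open V.
  apply: (@open_preimage_in _ _ (f \o chart_inv phi)); last exact: chart_dom_open.
    exact: chart_cod_open.
  move=> x xp; apply: continuous_comp; last exact: cf.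
  exact: chart_inv_continuous.
pose A z := phiL z + a.
have sA : smooth_on setT A by exact: se1.2.
have cA : continuous A by move=> x; apply: (Ck_continuous (sA 0)); exact/mem_set.
pose U := A @^-1` V.
have oU : open U by move/continuousP: cA; apply.
have Va : V a by split; [exact: chart_mapP|rewrite chart_mapK].
have U0 : U 0 by rewrite /U /= /A linear0 add0r.
have FE x : F x = G (A x) - b by [].
have sF : smooth_on U F.
  move=> n; apply: (@Ck_B _ _ _ n U (G \o A) (fun=> b)) => //; last exact: Ck_cst.
  apply: (@Ck_comp _ _ _ _ n U V A G) => //; last exact: sf.
  by apply: Ck_sub (sA n).
have Ga : G a = b by rewrite /G /a /= chart_mapK.
have F0 : F 0 = 0 by rewrite FE /A linear0 add0r Ga subrr.
pose T := tangent_map f m.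
have dF v : gderive F 0 v = T (phiL v).
  apply: diff_quotient_unique => //.
  have -> : diff_quotient F 0 v = diff_quotient G a (phiL v).
    apply/funext => t; rewrite /diff_quotient !FE opprB addrA subrK add0r.
    by rewrite /A linear0 add0r linearZ [_ *: _ + a]addrC.
  by apply: gderivableP; exact: ((sf i j 1).2.1 _ _ Va).
have pF : pseudo_inverse (gderive F 0) (psiL \o S).
  have -> : gderive F 0 = T \o phiL by apply/funext.
  split => /=.
  - exact: (linear_comp lS l2).
  - exact: (@comp_continuous _ _ _ S psiL).
  - by move=> x; rewrite K2; exact: TST.
  - by move=> y; rewrite K2; congr psiL; exact: STS.
have [nf [c [d [[sc sd] [cd0' cm0] [dd0 dm0] cdF [cnf fE]]]]] :=
  local_normal_form hj oU U0 sF F0 pF.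
have [hX hY] := (@nf_X_hausdorff _ nf, @nf_Y_hausdorff _ nf).
have c0m : chart_map c0 m = 0 by rewrite /= -/a subrr (lin0 l2).
have d0m : chart_map d0 (f m) = 0 by rewrite /= -/b subrr.
have c0d : chart_dom c0 m by split.
have d0d : chart_dom d0 (f m) by split.
have cm : chart_dom (chart_comp c0 c) m.
  by split; [exact: c0d|have := cd0'; rewrite -c0m].
have dm : chart_dom (chart_comp d0 d) (f m).
  by split; [exact: d0d|have := dd0; rewrite -d0m].
have cmm : chart_map (chart_comp c0 c) m = 0 by rewrite -[RHS]cm0 -c0m.
have dmm : chart_map (chart_comp d0 d) (f m) = 0 by rewrite -[RHS]dm0 -d0m.
exists nf, (chart_comp c0 c), (chart_comp d0 d); split.
- by split=> //; exact: compatible_chart_comp.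
- by split=> //; exact: compatible_chart_comp.
- move=> _ [n [cn dn] <-]; have [Un dFn] := cdF _ dn.
  have e : chart_inv c0 (chart_map c0 n) = n by rewrite chart_mapK.
  have fn : chart_dom psi (f (chart_inv c0 (chart_map c0 n))) by case: Un.
  rewrite e in fn; split; first by split.
  suff <- : F (chart_map c0 n) = chart_map d0 (f n) by [].
  by congr (chart_map d0 (f _)).
- by move=> x [/cnf].
- by move=> x1 x2 k1 k2 [xc _]; rewrite -fE.
Qed.

End Main.

Theorem theorem3p8 (R : realType) :
  (forall (M N : manifold R) (f : M -> N) (m : M),
      banach_manifold M -> smooth_map f ->
      (has_normal_form f m <-> regular_operator (tangent_map f m))) /\
  (forall (M N : manifold R) (f : M -> N),
      finite_dimensional_manifold M -> smooth_map f ->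
      forall m : M, has_normal_form f m).
Proof.
split=> [M N f m bM sf|M N f fM sf m].
  split; first exact: normal_form_tangent_regular.
  move=> /regular_pseudo_inverse; apply: regular_tangent_normal_form => //.
  exact: bM.
have [lT cT] := tangent_map_linear_continuous m sf.
apply: regular_tangent_normal_form => //.
  by apply: finite_dimensional_banach; [exact: mfd_model_hausdorff|exact: fM].
apply: finite_dimensional_pseudo_inverse => //; first exact: fM.
exact: mfd_model_hausdorff.
Qed.
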